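(* Let $a,b$ satisfy $0<a<b<1$, $b<(a+2)/3$ and $b<a(2+\sqrt3)$, and let $k>0$. Let $\bar u(z)$, $z\in(-\infty,0]$, be the shock-fronted receding travelling wave, with wave speed $c=-kD(0)$, defined in the context, and let $\mathcal{L}(\bar u)$ be the associated linearised operator on $L^2_0((-\infty,0))$ defined in the context. Suppose that $a$ and $b$ are such that $$\tfrac12 D(\bar u)_{zz}+R'(\bar u)<0\qquad\text{for all values } \bar u=u\in[0,u_l]\cup[u_r,1],$$ where $D(\bar u)_{zz}$ is regarded as a function of the value $u$ of $\bar u$ as described in the context. Then the travelling wave $\bar u$ is spectrally stable, i.e. every $\lambda\in\sigma(\mathcal{L}(\bar u))$ satisfies $\operatorname{Re}(\lambda)<0$.
   Context: Consider the reaction--diffusion equation $u_t=(D(u)u_x)_x+R(u)$ with $D(u)=(u-a)(u-b)$, where $0<a<b<1$. Set $$\Phi(u)=\int_1^u D(s)\,ds=\tfrac16(u-1)\bigl(2u^2+(2-3a-3b)u+2-3a-3b+6ab\bigr).$$ Let $k>0$, $\kappa=-k^2$, $A=-\kappa D(0)=k^2D(0)>0$, and $$R(u)=\left(\frac{A}{D(u)}+\kappa\right)\Phi(u).$$ Then $R(0)=R(1)=0$. The condition $b<(a+2)/3$ guarantees $\Phi(u)<0$ for $u\in[0,1)$. Shock endpoints: $u_l=\frac{a+b-\sqrt3\,(b-a)}{2}$ and $u_r=\frac{a+b+\sqrt3\,(b-a)}{2}$. They satisfy $\Phi(u_l)=\Phi(u_r)$ and $D(u_l)=D(u_r)$. The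 condition $b<a(2+\sqrt3)$ guarantees $u_l>0$. Travelling wave: let $z=x-ct$ with $c=-A/k=-kD(0)<0$. The wave $\bar u:(-\infty,0]\to[0,1)$ is determined by $\Phi(\bar u(z))=\Phi(0)e^{kz}$, with a jump at the shock location $z_s<0$ given by $\Phi(u_l)=\Phi(0)e^{kz_s}$: for $z<z_s$ one takes the branch with $\bar u(z)\in(u_r,1)$, and for $z_s<z\le 0$ the branch with $\bar u(z)\in[0,u_l)$. Thus $\bar u(0)=0$, $\bar u(z)\to1$ as $z\to-\infty$, $\bar u(z_s^-)=u_r$ and $\bar u(z_s^+)=u_l$. Away from the shock, $\bar u$ satisfies $(D(\bar u)\bar u_z)_z+c\bar u_z+R(\bar u)=0$ and $D(\bar u)\bar u_z=k\Phi(\bar u)$. Hence $D(\bar u)_{zz}$, the second $z$-derivative of $z\mapsto D(\bar u(z))$ away from the shock, is the following function of the value $u=\bar u(z)$: $$D(\bar u)_{zz}=k^2\,\frac{\Phi(u)}{D(u)}\,\frac{d}{du}\left(\frac{D'(u)\Phi(u)}{D(u)}\right).$$ The values at $u=u_l,u_r$ are understood as one-sided limits at the shock, and the value at $u=1$ as the limit $z\to-\infty$. Linearised operator: for $z\in(-\infty,z_s)\cup(z_s,0)$, $$\mathcal{L}(\bar u)p=(D(\bar u)p)_{zz}+c\,p_z+R'(\bar u)p .$$ It acts in $L^2_0((-\infty,0))$, the space of perturbations that are square integrable on $(-\infty,0)$, with the boundary conditions $p(0)=0$ and $\lim_{z\to-\infty}p(z)=0$, and with the requirement that $p$ be $C^1$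 across the shock $z=z_s$. Explicitly, the domain is the set of $p\in L^2((-\infty,0))$ whose restrictions to $(-\infty,z_s)$ and $(z_s,0)$ are in $H^2$, with $p(0)=0$ and with $p$ and $p_z$ continuous at $z_s$; the expression above is evaluated separately on each side of $z_s$. The spectrum $\sigma(\mathcal{L}(\bar u))$ is the set of $\lambda\in\mathbb{C}$ such that $\mathcal{L}(\bar u)-\lambda$ does not have a bounded inverse on this space. The wave $\bar u$ is called spectrally stable if $\lambda\in\sigma(\mathcal{L}(\bar u))$ implies $\operatorname{Re}(\lambda)<0$. *)

(* Defs.v *)
From HB Require Import structures.
From mathcomp Require Import all_boot all_order all_algebra.
From mathcomp Require Import complex.
From mathcomp Require Import all_classical all_reals all_analysis.
From mathcomp Require Import ring.

Set Implicit Arguments.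
Unset Strict Implicit.
Unset Printing Implicit Defensive.

Import Order.TTheory GRing.Theory Num.Theory.
Import numFieldNormedType.Exports.

Local Open Scope classical_set_scope.
Local Open Scope ring_scope.
Local Open Scope complex_scope.

Section nonlinearities.
Context {R : realType}.
Implicit Types a b k u : R.

Definition Dif a b u : R := (u - a) * (u - b).

(* The closed form of the oriented integral of Dif from 1 to u; this is
   justified by the two lemmas that follow. *)
Definition Phi a b u : R :=
  6^-1 * (u - 1) *
  (2 * u ^+ 2 + (2 - 3 * a - 3 * b) * u + 2 - 3 * a - 3 * b + 6 * a * b).

Lemma Phi1 a b : Phi a b 1 = 0.
Proof. by rewrite /Phi subrr mulr0 mul0r. Qed.

Lemma is_derive_Phi a b u : is_derive u 1 (Phi a b) (Dif a b u).
Proof.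
set c1 := 2 - 3 * a - 3 * b; set c2 := c1 + 6 * a * b.
pose p : {poly R} := 6^-1%:P * ('X - 1%:P) * (2%:P * 'X ^+ 2 + c1%:P * 'X + c2%:P).
have -> : Phi a b = horner p.
  by apply/funext => x; rewrite /p !(hornerM, hornerD, hornerN, hornerC, hornerX,
    horner_exp, hornerXn) /Phi /c2 /c1; ring.
have -> : Dif a b u = p^`().[u]; last exact: is_derive_poly.
rewrite /p !(derivM, derivD, derivN, derivC, derivX, derivXn).
rewrite !(hornerM, hornerD, hornerN, hornerC, hornerX, hornerMn, horner_exp,
  hornerXn).
by rewrite /Dif /c2 /c1; field.
Qed.

Definition Rsrc a b k u : R :=
  let kappa := - k ^+ 2 in
  let A := - kappa * Dif a b 0 in
  (A / Dif a b u + kappa) * Phi a b u.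

Definition u_l a b : R := (a + b - Num.sqrt 3 * (b - a)) / 2.
Definition u_r a b : R := (a + b + Num.sqrt 3 * (b - a)) / 2.

Definition speed a b k : R := - k * Dif a b 0.

(* The second z-derivative of z |-> Dif (ubar z), as a function of the value
   u = ubar z, using ubar_z = k Phi / Dif.  It is continuous where Dif does not
   vanish, so that its values at u_l, u_r and 1 are the limits along the wave. *)
Definition Dzz a b k u : R :=
  k ^+ 2 * (Phi a b u / Dif a b u) *
  derive1 (fun v => derive1 (Dif a b) v * Phi a b v / Dif a b v) u.

(* The values of ubar at zs and at positive arguments are irrelevant. *)
Definition shock_wave a b k (zs : R) (ubar : R -> R) : Prop :=
  [/\ zs < 0,
      Phi a b (u_l a b) = Phi a b 0 * expR (k * zs),
      (forall z, z < zs -> u_r a b < ubar z < 1 /\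
         Phi a b (ubar z) = Phi a b 0 * expR (k * z)) &
      (forall z, zs < z <= 0 -> 0 <= ubar z < u_l a b /\
         Phi a b (ubar z) = Phi a b 0 * expR (k * z))].

End nonlinearities.

Section complex_valued_functions.
Context {R : realType}.
Implicit Types (f g p : R -> R[i]) (I : set R).

Local Notation mu := (@lebesgue_measure R).

Definition ReF f : R -> R := fun z => complex.Re (f z).
Definition ImF f : R -> R := fun z => complex.Im (f z).

Definition deriv_c f : R -> R[i] := fun z => derive1 (ReF f) z +i* derive1 (ImF f) z.

Definition derivable_c f (z : R) : Prop :=
  derivable (ReF f) z 1 /\ derivable (ImF f) z 1.

Definition continuous_at_c f (z : R) : Prop :=
  {for z, continuous (ReF f)} /\ {for z, continuous (ImF f)}.

Definition Rintegral_c (A : set R) f : R[i] :=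
  Rintegral mu A (ReF f) +i* Rintegral mu A (ImF f).

Definition L2 I f : Prop :=
  ReF f \_ I \in Lfun mu 2%:E /\ ImF f \_ I \in Lfun mu 2%:E.

Definition L2norm I f : \bar R :=
  Lnorm mu 2%:E (EFin \o ((fun z => ComplexField.Normc.normc (f z)) \_ I)).

Definition ae_eq_on I f g : Prop := {ae mu, forall z, I z -> f z = g z}.

(* The Sobolev space H^2 of an open interval I, each class being identified
   with its C^1 representative: p is differentiable on I, p' is (locally)
   absolutely continuous with a.e. derivative p2, and p, p', p2 are in L^2.
   No condition is put on p outside I. *)
Definition H2 I p : Prop :=
  [/\ forall z, I z -> derivable_c p z,
      L2 I p, L2 I (deriv_c p) &
      exists2 p2 : R -> R[i], L2 I p2 &
        forall x y, I x -> I y -> x <= y ->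
          deriv_c p y - deriv_c p x = Rintegral_c `[x, y] p2].

(* T - lambda, with T an operator of domain dom in L^2(I), has an everywhere
   defined bounded two-sided inverse S.  Elements of L^2(I) are represented by
   functions, equality being almost everywhere on I. *)
Definition has_bounded_inverse I (dom : set (R -> R[i]))
    (T : (R -> R[i]) -> (R -> R[i])) (lambda : R[i]) : Prop :=
  exists S : (R -> R[i]) -> (R -> R[i]),
    [/\ forall f, L2 I f -> dom (S f) /\
          ae_eq_on I (fun z => T (S f) z - lambda * S f z) f,
        forall p f, dom p -> L2 I f ->
          ae_eq_on I (fun z => T p z - lambda * p z) f ->
          ae_eq_on I (S f) p &
        exists M : R, forall f, L2 I f ->
          (L2norm I (S f) <= M%:E * L2norm I f)%E].

Definition spectrum I (dom : set (R -> R[i]))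
    (T : (R -> R[i]) -> (R -> R[i])) : set R[i] :=
  [set lambda | ~ has_bounded_inverse I dom T lambda].

End complex_valued_functions.

Section linearisation.
Context {R : realType}.
Variables (a b k zs : R) (ubar : R -> R).

(* The condition p(0) = 0 is on the trace at 0 from the left; p(z) -> 0 as
   z -> -oo is automatic for H^2 functions. *)
Definition lin_dom : set (R -> R[i]) :=
  [set p | [/\ L2 `]-oo, 0[ p, H2 `]-oo, zs[ p, H2 `]zs, 0[ p,
     ReF p z @[z --> 0^'-] --> (0 : R) /\ ImF p z @[z --> 0^'-] --> (0 : R) &
     continuous_at_c p zs /\ continuous_at_c (deriv_c p) zs]].

(* The derivatives are classical; for p in lin_dom they exist almost
   everywhere, and on (-oo, zs) and (zs, 0) they agree with the weak ones. *)
Definition lin_op (p : R -> R[i]) : R -> R[i] := fun z =>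
  deriv_c (deriv_c (fun y => (Dif a b (ubar y))%:C * p y)) z
  + (speed a b k)%:C * deriv_c p z
  + (derive1 (Rsrc a b k) (ubar z))%:C * p z.

Definition spectrally_stable : Prop :=
  forall lambda : R[i],
    spectrum `]-oo, 0[ lin_dom lin_op lambda -> complex.Re lambda < 0.

End linearisation.

(* Main.v *)
Require Import Defs.
From HB Require Import structures.
From mathcomp Require Import all_boot all_order all_algebra.
From mathcomp Require Import complex.
From mathcomp Require Import all_classical all_reals all_analysis.
From mathcomp Require Import measurable_realfun ring lra.

Import Order.TTheory GRing.Theory Num.Theory.
Import numFieldNormedType.Exports.

(** Let lambda = m + i nu with m >= 0; the resolvent equation L p - lambda p = f
    has to be solved with a bound on p in terms of f.  Write D, D', D'' for D(ubar)
    and its z-derivatives.  Pairing the equation with p on each side of the shock and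
    integrating by parts gives, for the real parts,

      Re <L p, p> = - int D |p'|^2 + int (D''/2 + R') |p|^2
                    + (D'(zs-) - D'(zs+)) |p(zs)|^2 / 2,

    because p is C^1 across zs, D is continuous there, and the convection term
    c p' p is an exact derivative.  Both branches of ubar avoid the interval where D
    is negative, and there D >= (b - a)^2 / 2.  Since Phi and D agree at u_l and u_r,
    whereas the slope of D changes sign, D' is negative to the left of the shock
    and positive to its right, so the jump term is harmless.  By compactness of
    [0, u_l] and [u_r, 1] the hypothesis D''/2 + R' < 0 holds with a margin del > 0.
    With d0 = (b - a)^2 / 2 this gives the lemma energy: for x to the left of the
    shock, the integral over [x, 0] of d0 |p'|^2 + (del / 2) |p|^2 is at most that of
    |f|^2 / (2 del) plus a boundary flux at x, quadratic in p(x) and p'(x).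

    Uniqueness (resolvent_unique).  For the difference of two solutions, f = 0.
    If its energy were positive on some segment, the flux, and with it
    |p|^2 + |p'|^2, would stay bounded below all the way to minus infinity,
    against square integrability.

    Existence (resolvent_exists).  The equation is a linear ordinary differential
    equation with measurable coefficients.  Take a solution P with P(0) = 0 and the
    homogeneous solution H with H(0) = 0, H'(0) = 1.  For x to the left of the shock
    H(x) is nonzero, by the energy estimate, so that P + kappa H vanishes at x for
    some complex kappa(x).  The flux at x is then zero, and the energy estimate bounds
    P + kappa(x) H on [x, 0] by the norm of f alone.  In particular kappa(x) is
    bounded; a cluster point as x goes to minus infinity gives a solution
    on the half line obeying the same bound, up to a factor 2, on every segment; it
    is also the bound on the inverse.

    Elements of H^2 have a derivative which is only absolutely continuous, so all
    the calculus is phrased with the predicate primitive, and complex functions are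
    handled as pairs of real ones indexed by bool, true being the real part. *)

Set Implicit Arguments.
Unset Strict Implicit.
Unset Printing Implicit Defensive.

Local Open Scope classical_set_scope.
Local Open Scope ring_scope.
Local Open Scope complex_scope.

(** * Integrals over segments *)

Section segment_integrals.
Context {R : realType}.
Implicit Types (f g F G : R -> R) (x y z s t : R).

Local Notation mu := (@lebesgue_measure R).

Definition itg x y f : Prop := mu.-integrable `[x, y] (EFin \o f).

Definition segint x y f : R := \int[mu]_(t in `[x, y]) f t.

Lemma itgS x y s t f : itg x y f -> x <= s -> t <= y -> itg s t f.
Proof.
move=> fxy xs ty; apply: (integrableS _ _ _ fxy) => //.
by apply: subset_itv; rewrite bnd_simp.
Qed.

Lemma segint_pt x f : segint x x f = 0.
Proof. by rewrite /segint set_itv1 Rintegral_set1. Qed.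

Lemma segint_split x y z f : itg x z f -> x <= y -> y <= z ->
  segint x z f = segint x y f + segint y z f.
Proof.
move=> fxz xy yz; rewrite /segint -(Rintegral_itv_obnd_cbnd (r := y)); last first.
  apply: (integrableS _ _ _ fxz) => //.
  by apply: subset_itv; rewrite bnd_simp.
rewrite -(Rintegral_itvB (a := BLeft x) (x := y) fxz) ?bnd_simp//.
by rewrite addrCA subrr addr0.
Qed.

Lemma itgD x y f g : itg x y f -> itg x y g -> itg x y (fun t => f t + g t).
Proof. by move=> hf hg; exact: (integrableD _ hf hg). Qed.

Lemma itgZ x y k f : itg x y f -> itg x y (fun t => k * f t).
Proof. by move=> hf; exact: (integrableZl _ k hf). Qed.

Lemma itgN x y f : itg x y f -> itg x y (fun t => - f t).
Proof. by move=> hf; exact: (integrableN hf). Qed.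

Lemma itgB x y f g : itg x y f -> itg x y g -> itg x y (fun t => f t - g t).
Proof. by move=> hf hg; apply: itgD => //; exact: itgN. Qed.

Lemma itg_cst x y k : itg x y (fun=> k).
Proof.
apply: (@continuous_compact_integrable R (cst k)); first exact: segment_compact.
by apply: continuous_subspaceT => ?; exact: cvg_cst.
Qed.

Lemma itg_continuous x y f : {within `[x, y], continuous f} -> itg x y f.
Proof.
by move=> ?; apply: continuous_compact_integrable => //; exact: segment_compact.
Qed.

Lemma itg_meas x y f : itg x y f -> measurable_fun `[x, y] f.
Proof. by case/integrableP => /measurable_EFinP. Qed.

Lemma itgMl x y (M : R) f g : itg x y f -> measurable_fun `[x, y] g ->
  (forall t, x <= t <= y -> `|g t| <= M) -> itg x y (fun t => f t * g t).
Proof.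
move=> hf mg gM.
apply: (integrableMl _ hf mg) => //.
rewrite /bounded_near; near=> N => t /=; rewrite in_itv/= => txy.
apply: le_trans (gM _ txy) _.
by near: N; apply: nbhs_pinfty_ge; rewrite num_real.
Unshelve. all: by end_near. Qed.

Lemma segintD x y f g : itg x y f -> itg x y g ->
  segint x y (fun t => f t + g t) = segint x y f + segint x y g.
Proof. by move=> hf hg; rewrite /segint RintegralD. Qed.

Lemma segintB x y f g : itg x y f -> itg x y g ->
  segint x y (fun t => f t - g t) = segint x y f - segint x y g.
Proof. by move=> hf hg; rewrite /segint RintegralB. Qed.

Lemma segintZ x y k f : itg x y f -> segint x y (fun t => k * f t) = k * segint x y f.
Proof. by move=> hf; rewrite /segint RintegralZl. Qed.

Lemma segint_cst x y k : x <= y -> segint x y (fun=> k) = k * (y - x).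
Proof.
move=> xy; rewrite /segint Rintegral_cst//; congr (_ * _).
transitivity (fine (y - x)%:E) => //; congr fine.
rewrite [LHS]lebesgue_measure_itv/= lte_fin.
by case: ltgtP xy => //= -> _; rewrite subrr.
Qed.

Lemma le_segint x y f g : itg x y f -> itg x y g ->
  (forall t, x <= t <= y -> f t <= g t) -> segint x y f <= segint x y g.
Proof.
move=> hf hg fg; apply: le_Rintegral => // t; rewrite /= in_itv/=; exact: fg.
Qed.

Lemma segint_ge0 x y f : (forall t, x <= t <= y -> 0 <= f t) -> 0 <= segint x y f.
Proof. by move=> f0; apply: Rintegral_ge0 => t; rewrite /= in_itv/=; exact: f0. Qed.

Lemma itg_norm x y f : itg x y f -> itg x y (fun t => `|f t|).
Proof. exact: integrable_norm. Qed.

Lemma norm_segint x y f : itg x y f -> `|segint x y f| <= segint x y (fun t => `|f t|).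
Proof. by move=> hf; apply: le_normr_Rintegral. Qed.

Lemma eq_segint x y f g : (forall t, x <= t <= y -> f t = g t) ->
  segint x y f = segint x y g.
Proof.
by move=> fg; apply: eq_Rintegral => t; rewrite inE/= in_itv/=; exact: fg.
Qed.

Lemma eq_itg x y f g : (forall t, x <= t <= y -> f t = g t) ->
  itg x y f -> itg x y g.
Proof.
move=> fg; apply: eq_integrable => // t; rewrite inE/= in_itv/= => h.
by rewrite /= fg.
Qed.

Lemma le_itg x y f g : measurable_fun `[x, y] f -> itg x y g ->
  (forall t, x <= t <= y -> `|f t| <= `|g t|) -> itg x y f.
Proof.
move=> mf hg fg; apply: (le_integrable _ _ _ hg) => //.
  exact/measurable_EFinP.
Qed.

Lemma aeS (P Q : R -> Prop) : (forall t, P t -> Q t) ->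
  {ae mu, forall t, P t} -> {ae mu, forall t, Q t}.
Proof. by move=> PQ; apply: filterS PQ; exact: (ae_filter_ringOfSetsType mu). Qed.

Lemma aeI (P Q : R -> Prop) : {ae mu, forall t, P t} ->
  {ae mu, forall t, Q t} -> {ae mu, forall t, P t /\ Q t}.
Proof.
move=> aP aQ; apply: (filterS2 _ _ aP aQ) => //.
exact: (ae_filter_ringOfSetsType mu).
Qed.

Lemma ae_itg_segint x y f g : itg x y f -> measurable_fun `[x, y] g ->
  {ae mu, forall t, x <= t <= y -> f t = g t} ->
  itg x y g /\ segint x y f = segint x y g.
Proof.
move=> hf mg fg.
have fg' : ae_eq mu `[x, y]%classic (EFin \o f) (EFin \o g).
  apply: aeS fg => t /= h; rewrite in_itv/= => ht.
  by rewrite h.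
have mf : measurable_fun `[x, y] (EFin \o f).
  by apply/measurable_EFinP; exact: itg_meas.
have mg' : measurable_fun `[x, y] (EFin \o g) by apply/measurable_EFinP.
split; last by congr fine; exact: ae_eq_integral.
apply/integrableP; split => //.
case/integrableP: hf => _; apply: le_lt_trans.
rewrite le_eqVlt; apply/orP; left; apply/eqP.
apply: ae_eq_integral => //; try exact: measurableT_comp.
apply: aeS fg' => t h /h /= [].
by move=> ->.
Qed.

(** Passage from local to global: the supremum of the t for which P x t holds can
    be passed by joining on the local statement around it, so it is y. *)
Lemma cousin (P : R -> R -> Prop) x y :
  (forall s t u, x <= s -> s <= t -> t <= u -> u <= y -> P s t -> P t u -> P s u) ->
  (forall c, x <= c <= y -> exists2 d, 0 < d & forall s t,
      x <= s -> s <= c -> c <= t -> t <= y -> c - d < s -> t < c + d -> P s t) ->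
  x <= y -> P x y.
Proof.
move=> Padd Ploc xy.
pose A := [set t | x <= t <= y /\ P x t].
have Ax : A x.
  split; first by rewrite lexx.
  by have [|d d0 h] := Ploc x; [rewrite lexx|apply: h => //; lra].
have Ay : ubound A y by move=> t [/andP[]].
have hsA : has_sup A by split; [exists x|exists y].
pose c := sup A.
have xc : x <= c by apply: ub_le_sup => //; exists y.
have cy : c <= y by apply: ge_sup => //; exists x.
have [|d d0 h] := Ploc c; first by rewrite xc.
have [s [/andP[xs sy] Ps] cds] := sup_adherent d0 hsA.
have sc : s <= c.
  by apply: ub_le_sup; [exists y|split => //; rewrite xs].
have Pxt t : c <= t -> t <= y -> t < c + d -> P x t.
  move=> ct ty tcd; apply: (Padd x s t) => //; first by lra.
  by apply: h => //.
have [cdy|ycd] := ltP (c + d / 2) y; last first.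
  by apply: Pxt => //; lra.
have : c + d / 2 <= c.
  apply: ub_le_sup; first by exists y.
  split; first by lra.
  by apply: Pxt; lra.
lra.
Qed.

End segment_integrals.

(** * Absolutely continuous functions *)

Section primitives.
Context {R : realType}.
Implicit Types (f g F G : R -> R) (x y z s t : R).

Local Notation mu := (@lebesgue_measure R).

(** F is absolutely continuous with density f, which is the sense in which the
    derivative of an element of H^2 has a derivative. *)
Definition primitive x y F f : Prop :=
  itg x y f /\ forall s t, x <= s -> s <= t -> t <= y -> F t - F s = segint s t f.

Lemma primitiveS x y s t F f :
  primitive x y F f -> x <= s -> t <= y -> primitive s t F f.
Proof.
move=> [hf hF] xs ty; split; first exact: itgS hf xs ty.
by move=> u v su uv vt; apply: hF => //; lra.
Qed.

Lemma eq_primitive x y F G f g : primitive x y F f ->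
  (forall t, x <= t <= y -> F t = G t) ->
  (forall t, x <= t <= y -> f t = g t) -> primitive x y G g.
Proof.
move=> [hf hF] FG fg; split; first exact: eq_itg hf.
move=> s t xs st ty; rewrite -!FG; [|lra..].
by rewrite hF//; apply: eq_segint => u hu; apply: fg; lra.
Qed.

Lemma primitive_segint_right x y c f : itg x y f ->
  primitive x y (fun t => c - segint t y f) f.
Proof.
move=> hf; split => // s t xs st ty.
rewrite (@segint_split _ s t y)//; first by ring.
by apply: itgS hf _ _; lra.
Qed.

Lemma primitive_continuous x y F f : primitive x y F f ->
  {within `[x, y], continuous F}.
Proof.
have [yx|xy] := ltP y x.
  by rewrite set_itv_ge ?bnd_simp -?ltNge// => _; exact: continuous_subspace0.
move=> [hf hF].
apply: (@subspace_eq_continuous _ _ _ (fun t => F x + segint x t f)).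
  move=> t; rewrite inE/= in_itv/= => txy.
  have -> : segint x t f = F t - F x by rewrite hF//; lra.
  by rewrite addrC subrK.
have H := parameterized_integral_continuous xy hf.
move=> t; apply: cvgD; first exact: cvg_cst.
exact: H.
Qed.

Lemma within_continuousP x y F c e : {within `[x, y], continuous F} ->
  x <= c <= y -> 0 < e -> exists2 d, 0 < d & forall t, x <= t <= y ->
    c - d < t < c + d -> `|F t - F c| <= e.
Proof.
move=> /subspace_continuousP cF cxy e0.
have {}cF := cF c; have /cF : `[x, y]%classic c by rewrite /= in_itv.
move=> /cvgrPdist_le/(_ _ e0); rewrite /prop_near1/= /within/= => -[d /= d0 dP].
exists d => // t txy tcd; rewrite distrC; apply: dP => /=; last by rewrite in_itv.
by rewrite /ball/= ltr_norml; lra.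
Qed.

Lemma primitive_meas x y F f : primitive x y F f -> measurable_fun `[x, y] F.
Proof.
by move/primitive_continuous; exact: subspace_continuous_measurable_fun.
Qed.

Lemma within_continuous_bounded x y F : {within `[x, y], continuous F} ->
  exists M, forall t, x <= t <= y -> `|F t| <= M.
Proof.
move=> cF; have [yx|xy] := ltP y x; first by exists 0 => t; lra.
have cN : {within `[x, y], continuous (fun t => `|F t|)}.
  by move=> t; apply: cvg_norm; exact: cF.
have [c _ cP] := EVT_max xy cN.
by exists `|F c| => t txy; apply: cP; rewrite in_itv.
Qed.

Lemma primitive_itgM x y F f g : primitive x y F f -> itg x y g ->
  itg x y (fun t => g t * F t).
Proof.
move=> hF hg; have [M FM] := within_continuous_bounded (primitive_continuous hF).
exact: itgMl hg (primitive_meas hF) FM.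
Qed.

Lemma primitiveD x y F G f g : primitive x y F f -> primitive x y G g ->
  primitive x y (fun t => F t + G t) (fun t => f t + g t).
Proof.
move=> [hf hF] [hg hG]; split; first exact: itgD.
move=> s t xs st ty; rewrite segintD; [|by apply: itgS; eauto..].
by rewrite -hF// -hG//; ring.
Qed.

Lemma primitiveZ x y k F f : primitive x y F f ->
  primitive x y (fun t => k * F t) (fun t => k * f t).
Proof.
move=> [hf hF]; split; first exact: itgZ.
move=> s t xs st ty; rewrite segintZ; [|by apply: itgS; eauto..].
by rewrite -hF//; ring.
Qed.

Lemma primitiveB x y F G f g : primitive x y F f -> primitive x y G g ->
  primitive x y (fun t => F t - G t) (fun t => f t - g t).
Proof.
move=> hF hG; apply: eq_primitive (primitiveD hF (primitiveZ (-1) hG)) _ _ => t _;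
  by rewrite mulN1r.
Qed.

(** A density matters only almost everywhere; this is what turns the equation
    satisfied almost everywhere by an element of the domain into a system. *)
Lemma primitive_ae x y F f g : primitive x y F f -> measurable_fun `[x, y] g ->
  {ae mu, forall t, x <= t <= y -> f t = g t} -> primitive x y F g.
Proof.
move=> [hf hF] mg fg; have [hg _] := ae_itg_segint hf mg fg.
split => // s t xs st ty; rewrite hF//.
have [|||_ ->//] := @ae_itg_segint _ s t f g.
- exact: itgS hf _ _.
- apply: measurable_funS mg => //.
  by apply: subset_itv; rewrite bnd_simp.
- by apply: aeS fg => u hu u1; apply: hu; lra.
Qed.

Lemma primitive_increment_le x y F f g : x <= y -> primitive x y F f ->
  itg x y g -> (forall t, x <= t <= y -> g t <= f t) ->
  segint x y g <= F y - F x.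
Proof. by move=> xy [hf ->]// hg gf; exact: le_segint. Qed.

(** Locally, replacing one factor by its value at an endpoint costs an
   arbitrarily small multiple of the total variation; summing over a
   subdivision gives the product rule. *)
Lemma primitiveM x y F G f g : x <= y -> primitive x y F f -> primitive x y G g ->
  primitive x y (fun t => F t * G t) (fun t => f t * G t + g t * F t).
Proof.
move=> xy hF hG; have cF := primitive_continuous hF.
have cG := primitive_continuous hG.
have ih : itg x y (fun t => f t * G t + g t * F t).
  by apply: itgD; apply: primitive_itgM; [exact: hG|exact: hF.1|exact: hF|exact: hG.1].
have iv : itg x y (fun t => `|f t| + `|g t|).
  by apply: itgD; apply: itg_norm; [exact: hF.1|exact: hG.1].
suff key s t e : x <= s -> s <= t -> t <= y -> 0 < e ->
    `|F t * G t - F s * G s - segint s t (fun t => f t * G t + g t * F t)| <=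
    e * segint s t (fun t => `|f t| + `|g t|).
  split => // s t xs st ty; apply/eqP; rewrite -subr_eq0 -normr_le0.
  apply/ler_addgt0Pl => e e0; rewrite addr0.
  set V := segint s t (fun t => `|f t| + `|g t|).
  have V0 : 0 <= V by apply: segint_ge0 => u _; exact: addr_ge0.
  have V1 : 0 < V + 1 by lra.
  apply: le_trans (key s t (e / (V + 1)) _ _ _ _) _ => //; first exact: divr_gt0.
  rewrite -/V mulrAC ler_pdivrMr//; nra.
move=> xs st ty e0.
pose P s t := `|F t * G t - F s * G s - segint s t (fun t => f t * G t + g t * F t)| <=
    e * segint s t (fun t => `|f t| + `|g t|).
rewrite -/(P s t); apply: (@cousin _ P s t _ _ st).
  move=> a b c sa ab bc ct; rewrite /P => h1 h2.
  have := @segint_split _ a b c _ _ ab bc; move=> spl.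
  rewrite !spl; [|by apply: itgS iv _ _; lra|by apply: itgS ih _ _; lra].
  rewrite mulrDr; apply: le_trans (lerD h1 h2).
  apply: le_trans (ler_normD _ _); rewrite le_eqVlt; apply/orP; left.
  by apply/eqP; congr (`|_|); ring.
move=> c sct; have e2 : 0 < e / 2 by lra.
have [|d1 d10 h1] := within_continuousP cF (c := c) _ e2; first by lra.
have [|d2 d20 h2] := within_continuousP cG (c := c) _ e2; first by lra.
exists (Num.min d1 d2); first by rewrite lt_min d10.
move=> a b sa ac cb bt acd bcd.
have acd' : c - d1 < a /\ c - d2 < a.
  by split; apply: le_lt_trans acd; rewrite lerD2l lerN2 ge_min lexx ?orbT.
have bcd' : b < c + d1 /\ b < c + d2.
  by split; apply: (lt_le_trans bcd); rewrite lerD2l ge_min lexx ?orbT.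
have dF u v : a <= u <= b -> a <= v <= b -> `|F u - F v| <= e.
  move=> hu hv; have := h1 u; have := h1 v; rewrite !ler_norml; lra.
have dG u v : a <= u <= b -> a <= v <= b -> `|G u - G v| <= e.
  move=> hu hv; have := h2 u; have := h2 v; rewrite !ler_norml; lra.
rewrite /P.
have ab : a <= b by lra.
have xa : x <= a by lra.
have by' : b <= y by lra.
have jf : itg a b f by apply: itgS hF.1 _ _.
have jg : itg a b g by apply: itgS hG.1 _ _.
have jh := itgS ih xa by'.
have -> : F b * G b - F a * G a - segint a b (fun t => f t * G t + g t * F t) =
   segint a b (fun t => (G b * f t + F a * g t) - (f t * G t + g t * F t)).
  rewrite segintB//; last by apply: itgD; exact: itgZ.
  rewrite (@segintD _ a b (fun t => G b * f t)); [|exact: itgZ..].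
  by rewrite !segintZ// -hF.2// -hG.2//; ring.
have jk : itg a b (fun t => G b * f t + F a * g t - (f t * G t + g t * F t)).
  by apply: itgB => //; apply: itgD; exact: itgZ.
apply: le_trans (norm_segint jk) _; rewrite -segintZ; last by apply: itgS iv _ _.
apply: le_segint; [exact: itg_norm|by apply: itgZ; apply: itgS iv _ _|].
move=> u uab.
have -> : G b * f u + F a * g u - (f u * G u + g u * F u) =
  (G b - G u) * f u + (F a - F u) * g u by ring.
apply: le_trans (ler_normD _ _) _; rewrite !normrM mulrDr.
by apply: lerD; apply: ler_wpM2r => //; [apply: dG|apply: dF]; lra.
Qed.

Lemma primitive_C1 x y F f : x <= y ->
  {within `[x, y], continuous F} -> {within `[x, y], continuous f} ->
  (forall t, x < t < y -> is_derive t 1 F (f t)) -> primitive x y F f.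
Proof.
move=> xy cF cf dF; split; first exact: itg_continuous.
move=> s t xs; rewrite le_eqVlt => /orP[/eqP ->|st ty].
  by rewrite segint_pt subrr.
have sub : `[s, t] `<=` `[x, y] by apply: subset_itv; rewrite bnd_simp//; lra.
have cFst := continuous_subspaceW sub cF.
have cfst := continuous_subspaceW sub cf.
have [_ Fs Ft] := (continuous_within_itvP _ st).1 cFst.
rewrite /segint /Rintegral (@continuous_FTC2 _ f F)//.
- split => // u; rewrite in_itv/= => ust.
  by have := dF u; case; first by lra.
- move=> u; rewrite in_itv/= => ust; rewrite derive1E.
  by have := dF u; case; first by lra.
Qed.

End primitives.

Section gluing.
Context {R : realType}.
Implicit Types (f g F G D : R -> R) (x y z s t : R).

Local Notation mu := (@lebesgue_measure R).

Lemma itg_glue x y z f : x <= y -> y <= z -> itg x y f -> itg y z f -> itg x z f.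
Proof.
move=> xy yz fxy fyz; apply/(integrable_mkcond _ _) => //.
have {}fyz : mu.-integrable `]y, z] (EFin \o f).
  apply: (integrableS _ _ _ fyz) => //.
  by apply: subset_itv; rewrite bnd_simp.
move/(integrable_mkcond _ _) : fxy => fxy.
move/(integrable_mkcond _ _) : fyz => fyz.
apply: eq_integrable (integrableD _ (fxy _) (fyz _)) => //.
move=> t _ /=; rewrite /patch !mem_setE/= !in_itv/=.
have [tx|xt] := ltP t x; first by rewrite /= ifF ?adde0//; lra.
have [ty|yt] := leP t y; last by rewrite /= add0e.
by rewrite /= adde0 (le_trans ty yz).
Qed.

Lemma itg_change_left x y f g : (forall t, x < t <= y -> f t = g t) ->
  itg x y f -> itg x y g.
Proof.
move=> fg hf.
have [] // := @ae_itg_segint _ x y f g hf.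
  apply/measurable_fun_itv_obnd_cbndP.
  apply: (@eq_measurable_fun _ _ _ _ _ f).
    by move=> t; rewrite inE/= in_itv/= => ht; exact: fg.
  by apply/measurable_fun_itv_obnd_cbndP; exact: itg_meas.
exists [set x]; split => //; first exact: lebesgue_measure_set1.
move=> t /= /not_implyP[txy fgt].
by apply: contra_notP fgt => /eqP tx; apply: fg; lra.
Qed.

Lemma primitive_change_left x y F f g : (forall t, x < t <= y -> f t = g t) ->
  primitive x y F f -> primitive x y F g.
Proof.
move=> fg hF; apply: primitive_ae (hF) _ _.
  by apply: itg_meas; exact: itg_change_left fg hF.1.
exists [set x]; split => //; first exact: lebesgue_measure_set1.
move=> t /= /not_implyP[txy fgt].
by apply: contra_notP fgt => /eqP tx; apply: fg; lra.
Qed.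

Lemma continuous_inv_meas x y D (d0 : R) : 0 < d0 -> {within `[x, y], continuous D} ->
  (forall t, x <= t <= y -> d0 <= D t) -> measurable_fun `[x, y] (fun t => (D t)^-1).
Proof.
move=> d00 cD dD; apply: subspace_continuous_measurable_fun => //.
apply/subspace_continuousP => t txy; apply: cvgV.
  move: txy; rewrite /= in_itv/= => /dD; lra.
by move/subspace_continuousP : cD; apply.
Qed.

Lemma itg_sqr x y f : measurable_fun `[x, y] f -> itg x y (fun t => f t ^+ 2) ->
  itg x y f.
Proof.
move=> mf f2; apply: le_itg (itgD (itg_cst x y 1) f2) _ => // t _.
rewrite [leRHS]ger0_norm; last by rewrite addr_ge0 ?sqr_ge0.
by rewrite -(real_normK (num_real (f t))); nra.
Qed.

End gluing.

(** * Differential equations with measurable coefficients *)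

Section caratheodory.
Context {R : realType}.
Implicit Types (x z s t : R).

Local Notation mu := (@lebesgue_measure R).

(** The sequences u m - 2 B / 2^m and u m + 2 B / 2^m are monotone and bound each
    other, so the supremum of the first is the limit, with an explicit rate. *)
Lemma geometric_limit (u : nat -> R) (B : R) :
  (forall m, `|u m.+1 - u m| <= B / 2 ^+ m) ->
  exists l, forall m, `|l - u m| <= 2 * B / 2 ^+ m.
Proof.
move=> uB.
have p2 m : 0 < (2 : R) ^+ m by exact: exprn_gt0.
have B0 : 0 <= B by have := uB 0%N; rewrite expr0 divr1; apply: le_trans.
have half m : 2 * B / 2 ^+ m.+1 = B / 2 ^+ m.
  by rewrite exprS invfM mulrACA mulfV ?mul1r.
pose v m := u m + 2 * B / 2 ^+ m; pose w m := u m - 2 * B / 2 ^+ m.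
have two m : 2 * B / 2 ^+ m = B / 2 ^+ m + B / 2 ^+ m.
  by rewrite -mulrA mulr2n mulrDl !mul1r.
have vS : nonincreasing_seq v.
  apply/nonincreasing_seqP => m; rewrite /v half two.
  by have := uB m; rewrite ler_norml; lra.
have wS : nondecreasing_seq w.
  apply/nondecreasing_seqP => m; rewrite /w half two.
  by have := uB m; rewrite ler_norml; lra.
have B2 m : 0 <= 2 * B / 2 ^+ m by rewrite divr_ge0 ?mulr_ge0// ltW.
have wv n m : w n <= v m.
  apply: (@le_trans _ _ (w (maxn n m))); first by apply: wS; exact: leq_maxl.
  apply: (@le_trans _ _ (v (maxn n m))); last by apply: vS; exact: leq_maxr.
  by rewrite /w /v; have := B2 (maxn n m); lra.
exists (sup (range w)) => m.
have h1 : w m <= sup (range w).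
  by apply: ub_le_sup; [exists (v 0%N) => _ [n _ <-]|exists m].
have h2 : sup (range w) <= v m.
  by apply: ge_sup; [exists (w 0%N); exists 0%N|move=> _ [n _ <-]].
by move: h1 h2; rewrite /w /v ler_norml; lra.
Qed.

Lemma half_pow_small (B e : R) : 0 < e -> \forall m \near \oo, B / 2 ^+ m <= e.
Proof.
move=> e0.
have h : geometric B (2^-1 : R) @ \oo --> (0 : R).
  by apply: cvg_geometric; rewrite ger0_norm ?invr_ge0// invf_lt1// ltr1n.
move/cvgrPdist_le : h => /(_ _ e0); apply: filterS => m.
by rewrite sub0r normrN /geometric/= exprVn => /(le_trans (ler_norm _)).
Qed.

Lemma primitive_expR (k x y : R) : x <= y -> k != 0 ->
  primitive x y (fun t => expR (k * t) / k) (fun t => expR (k * t)).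
Proof.
move=> xy k0.
have ck : continuous (fun t => expR (k * t)).
  move=> t; apply: (@continuous_comp _ _ _ (fun t => k * t) expR).
    by apply: continuousM; [exact: cvg_cst|exact: cvg_id].
  exact: continuous_expR.
apply: primitive_C1 => //.
- by apply: continuous_subspaceT => t; apply: cvgM; [exact: ck|exact: cvg_cst].
- by apply: continuous_subspaceT.
- move=> t _; apply: is_derive_eq.
  by rewrite !(scaler0, add0r, addr0, scaler1, mulr1)/= /GRing.scale/=; field.
Qed.

(** Picard iteration, starting from 0.  In the norm weighted by exp(- 2 K z) the
    integral operator has Lipschitz constant 1/2, so that the iterates converge on
    the whole half line at once; the right-hand side need only be measurable in z. *)
Lemma caratheodory_exists (I : Type) (F : I -> R -> (I -> R) -> R)
    (c : I -> R) (K C H : R) : 1 <= K ->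
  (forall i z y y' (B : R), z <= 0 -> (forall j, `|y j - y' j| <= B) ->
     `|F i z y - F i z y'| <= K * B) ->
  (forall i x (y : I -> R -> R),
     (forall j, measurable_fun `[x, 0] (y j) /\
        exists M : R, forall t, x <= t <= 0 -> `|y j t| <= M) ->
     itg x 0 (fun z => F i z (y^~ z))) ->
  (forall i, `|c i| <= C) ->
  (forall i z, z <= 0 -> `|segint z 0 (fun s => F i s (fun=> 0))| <= H * expR (- z)) ->
  exists y : I -> R -> R, forall i, y i 0 = c i /\
    forall x, x <= 0 -> primitive x 0 (y i) (fun z => F i z (y^~ z)).
Proof.
move=> K1 lipF itgF cC hH.
have K0 : 0 < K by lra.
pose pic := fix pic m : I -> R -> R := if m is m'.+1 then
  fun i z => c i - segint z 0 (fun s => F i s ((pic m')^~ s)) else fun _ _ => 0.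
have good m x j : measurable_fun `[x, 0] (pic m j) /\
    exists M : R, forall t, x <= t <= 0 -> `|pic m j t| <= M.
  elim: m j => [j|m IH j] /=.
    by split; [exact: measurable_cst|exists 0 => t _; rewrite normr0].
  have h := primitive_segint_right (c j) (itgF j x _ IH).
  split; first exact: primitive_meas h.
  exact: within_continuous_bounded (primitive_continuous h).
pose E z := expR (- (2 * K) * z).
have E0 z : 0 < E z by exact: expR_gt0.
have K2 : - (2 * K) != 0 by rewrite oppr_eq0; apply: lt0r_neq0; lra.
have itgE z : z <= 0 -> itg z 0 E by move=> z0; apply: (primitive_expR z0 K2).1.
have intE z : z <= 0 -> segint z 0 E <= E z / (2 * K).
  move=> z0; have [_ <-//] := primitive_expR z0 K2.
  rewrite mulr0 expR0 -/(E z) invrN.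
  have : 0 < (2 * K)^-1 by rewrite invr_gt0; lra.
  lra.
have lipint m (y : I -> R -> R) (B : R) i z : z <= 0 -> 0 <= B ->
    (forall x j, measurable_fun `[x, 0] (y j) /\
      exists M : R, forall t, x <= t <= 0 -> `|y j t| <= M) ->
    (forall j t, t <= 0 -> `|y j t - pic m j t| <= B * E t) ->
    `|segint z 0 (fun s => F i s (y^~ s)) -
      segint z 0 (fun s => F i s ((pic m)^~ s))| <= B / 2 * E z.
  move=> z0 B0 gy hB.
  have i1 := itgF i z _ (gy z); have i2 := itgF i z _ (good m z).
  rewrite -segintB//; apply: le_trans (norm_segint (itgB i1 i2)) _.
  apply: (@le_trans _ _ (segint z 0 (fun s => (K * B) * E s))).
    apply: le_segint; [exact: itg_norm (itgB i1 i2)|by apply: itgZ; exact: itgE|].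
    move=> t tz; rewrite -mulrA; apply: lipF; first by lra.
    by move=> j; apply: hB; lra.
  rewrite segintZ; last exact: itgE.
  apply: (@le_trans _ _ ((K * B) * (E z / (2 * K)))).
    by apply: ler_wpM2l; [apply: mulr_ge0 => //; lra|exact: intE].
  rewrite le_eqVlt; apply/orP; left; apply/eqP; field.
  by rewrite lt0r_neq0.
have [[i0 _]|noI] := pselect (exists i : I, True); last first.
  exists (fun _ _ => 0) => i; exfalso; apply: noI; by exists i.
have C0 : 0 <= C by apply: le_trans (cC i0).
have H0 : 0 <= H.
  by have := hH i0 0 (lexx _); rewrite oppr0 expR0 mulr1; apply: le_trans.
have B0 : 0 <= C + H by exact: addr_ge0.
have step m i z : z <= 0 -> `|pic m.+1 i z - pic m i z| <= (C + H) / 2 ^+ m * E z.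
  elim: m i z => [|m IH] i z z0.
    rewrite expr0 divr1 /= subr0 mulrDl; apply: le_trans (ler_normB _ _) _.
    apply: lerD.
      apply: le_trans (cC i) _; rewrite ler_peMr//.
      by rewrite /E -[leLHS]expR0 ler_expR; nra.
    apply: le_trans (hH i z z0) _; apply: ler_wpM2l; first exact: H0.
    by rewrite ler_expR; nra.
  have -> : pic m.+2 i z - pic m.+1 i z =
     - (segint z 0 (fun s => F i s ((pic m.+1)^~ s)) -
        segint z 0 (fun s => F i s ((pic m)^~ s))) by rewrite /=; ring.
  rewrite normrN; have -> : (C + H) / 2 ^+ m.+1 = (C + H) / 2 ^+ m / 2.
    by rewrite exprS invfM; ring.
  apply: lipint => //.
  by apply: divr_ge0 => //; exact: exprn_ge0.
have lim i z : exists l, z <= 0 ->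
    forall m, `|l - pic m i z| <= 2 * ((C + H) * E z) / 2 ^+ m.
  have [z0|zN] := boolP (z <= 0); last by exists 0 => z0; case/negP: zN.
  have [m|l hl] := @geometric_limit (fun m => pic m i z) ((C + H) * E z).
    by rewrite mulrAC; exact: step.
  by exists l.
pose y i := projT1 (choice (lim i)).
have hy i z : z <= 0 ->
    forall m, `|y i z - pic m i z| <= 2 * ((C + H) * E z) / 2 ^+ m.
  exact: (projT2 (choice (lim i)) z).
have gy x j : measurable_fun `[x, 0] (y j) /\
    exists M : R, forall t, x <= t <= 0 -> `|y j t| <= M.
  split.
    apply: (@measurable_fun_cvg _ _ _ _ (fun m => pic m j)).
    - by move=> m; case: (good m x j).
    - move=> t; rewrite /= in_itv/= => tx0.
      apply/cvgrPdist_le => e e0; near=> m.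
      have t0 : t <= 0 by case/andP: tx0.
      apply: le_trans (hy j t t0 m) _; near: m; exact: half_pow_small.
  exists (2 * ((C + H) * E x)) => t txt.
  have := hy j t _ 0%N; rewrite subr0 expr0 divr1 => h.
  apply: le_trans (h _) _; first by lra.
  apply: ler_wpM2l => //; apply: ler_wpM2l => //.
  by rewrite ler_expR; nra.
exists y.
suff eqn i z : z <= 0 -> y i z = c i - segint z 0 (fun s => F i s (y^~ s)).
  move=> i; split; first by rewrite eqn// segint_pt subr0.
  move=> x x0; apply: eq_primitive (primitive_segint_right (c i) (itgF i x _ (gy x))) _ _ => //.
  by move=> t tx; rewrite [RHS]eqn//; lra.
move=> z0; apply/eqP; rewrite -subr_eq0 -normr_le0.
apply/ler_addgt0Pl => e e0; rewrite addr0; near \oo => m.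
have h1 := hy i z z0 m.+1.
have p2 : (0 : R) < 2 ^+ m by exact: exprn_gt0.
have h2 := @lipint m y (2 * (C + H) / 2 ^+ m) i z z0 _ gy.
have {}h2 : `|segint z 0 (fun s => F i s (y^~ s)) -
    segint z 0 (fun s => F i s ((pic m)^~ s))| <= 2 * (C + H) / 2 ^+ m / 2 * E z.
  apply: h2; first by rewrite divr_ge0 ?mulr_ge0 ?(ltW p2)//; exact: B0.
  by move=> j t t0; have := hy j t t0 m; rewrite mulrA mulrAC.
have -> : y i z - (c i - segint z 0 (fun s => F i s (y^~ s))) =
  (y i z - pic m.+1 i z) + (segint z 0 (fun s => F i s (y^~ s)) -
    segint z 0 (fun s => F i s ((pic m)^~ s))) by rewrite /=; ring.
apply: le_trans (ler_normD _ _) _; apply: le_trans (lerD h1 h2) _.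
have -> : 2 * ((C + H) * E z) / 2 ^+ m.+1 + 2 * (C + H) / 2 ^+ m / 2 * E z =
   2 * ((C + H) * E z) / 2 ^+ m by rewrite exprS; field; rewrite lt0r_neq0.
near: m; exact: half_pow_small.
Unshelve. all: by end_near. Qed.

End caratheodory.

(** * The energy identity on one side of the shock *)

Section energy.
Context {R : realType}.
Implicit Types (x y z s t : R).

Local Notation mu := (@lebesgue_measure R).

(** What the energy argument uses of the coefficients on one side of the shock:
    D stands for D(ubar), D1 and D2 for its first two z-derivatives, N for R'(ubar),
    and del is the margin in the stability condition. *)
Record branch (x y d0 del K : R) (D D1 D2 N : R -> R) : Prop := Branch {
  branch_D : primitive x y D D1;
  branch_D1 : primitive x y D1 D2;
  branch_N : measurable_fun `[x, y] N;
  branch_ge : forall t, x <= t <= y -> d0 <= D t;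
  branch_neg : forall t, x <= t <= y -> D2 t / 2 + N t <= - del;
  branch_bound : forall t, x <= t <= y ->
    [/\ `|D t| <= K, `|D1 t| <= K, `|D2 t| <= K & `|N t| <= K] }.

Lemma branchS x y s t d0 del K D D1 D2 N : branch x y d0 del K D D1 D2 N ->
  x <= s -> t <= y -> branch s t d0 del K D D1 D2 N.
Proof.
move=> [h1 h2 h3 h4 h5 h6] xs ty; split.
- exact: primitiveS h1 xs ty.
- exact: primitiveS h2 xs ty.
- by apply: measurable_funS h3 => //; apply: subset_itv; rewrite bnd_simp.
- by move=> u hu; apply: h4; lra.
- by move=> u hu; apply: h5; lra.
- by move=> u hu; apply: h6; lra.
Qed.

Variables (c m nu : R).

(** The sign with which the imaginary part of lambda couples the two components:
    i nu p has real part - nu Im p and imaginary part nu Re p. *)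
Definition sg (b : bool) : R := if b then 1 else -1.

(** The second derivative that the resolvent equation prescribes for the
    component b of p, given P = p and Q = p'. *)
Definition second (D D1 D2 N : R -> R) (f P Q : bool -> R -> R) b t : R :=
  (f b t - (2 * D1 t + c) * Q b t - (D2 t + N t - m) * P b t
     - sg b * nu * P (~~ b) t) * (D t)^-1.

Definition solves x y D D1 D2 N (f P Q : bool -> R -> R) : Prop := forall b,
  primitive x y (P b) (Q b) /\ primitive x y (Q b) (second D D1 D2 N f P Q b).

Definition density (d0 del : R) (P Q : bool -> R -> R) t : R :=
  d0 * (Q true t ^+ 2 + Q false t ^+ 2) + del / 2 * (P true t ^+ 2 + P false t ^+ 2).

Definition mass (f : bool -> R -> R) t : R := f true t ^+ 2 + f false t ^+ 2.

(** The boundary term of the integration by parts.  The summand c / 2 makes the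
    convection term disappear from its derivative. *)
Definition flux (D D1 : R -> R) (P Q : bool -> R -> R) t : R :=
  (D t * Q true t + D1 t / 2 * P true t + c / 2 * P true t) * P true t +
  (D t * Q false t + D1 t / 2 * P false t + c / 2 * P false t) * P false t.

Lemma itg_density x y d0 del P Q F G : (forall b, primitive x y (P b) (F b)) ->
  (forall b, primitive x y (Q b) (G b)) -> itg x y (density d0 del P Q).
Proof.
move=> hP hQ.
have sq u w : primitive x y u w -> itg x y (fun t => u t ^+ 2).
  move=> hu; apply: (primitive_itgM hu); apply: itg_continuous.
  exact: primitive_continuous hu.
by apply: itgD; apply: itgZ; apply: itgD; apply: sq.
Qed.

Lemma young (del p q : R) : 0 < del ->
  - (p * q) <= del / 2 * p ^+ 2 + (2 * del)^-1 * q ^+ 2.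
Proof.
move=> d0; have : 0 <= (del * p + q) ^+ 2 * (2 * del)^-1.
  by rewrite mulr_ge0 ?sqr_ge0 ?invr_ge0; lra.
have -> : (del * p + q) ^+ 2 * (2 * del)^-1 =
  del / 2 * p ^+ 2 + p * q + (2 * del)^-1 * q ^+ 2 by field; rewrite lt0r_neq0.
lra.
Qed.

(** Square integrability of p'' follows from that of f, p and p'. *)
Lemma second_sqr_le x y d0 del K D D1 D2 N f P Q b t :
  branch x y d0 del K D D1 D2 N -> 0 < d0 -> x <= t <= y ->
  second D D1 D2 N f P Q b t ^+ 2 <=
  4 * ((1 + 4 * K + `|c| + `|m| + `|nu|) / d0) ^+ 2 *
    (mass f t + mass P t + mass Q t).
Proof.
move=> br d00 ht; have Dt := branch_ge br ht.
have [bD b1 b2 b3] := branch_bound br ht.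
pose L := 1 + 4 * K + `|c| + `|m| + `|nu|; rewrite -/L.
have K0 : 0 <= K by apply: le_trans bD.
have cn := normr_ge0 c; have mn := normr_ge0 m; have nn := normr_ge0 nu.
have L0 : 0 <= L by rewrite /L; lra.
have sqL (w : R) : `|w| <= L -> w ^+ 2 <= L ^+ 2.
  by move=> wL; rewrite -(real_normK (num_real w)); rewrite !expr2 ler_pM.
have h1 : (2 * D1 t + c) ^+ 2 <= L ^+ 2.
  apply: sqL; apply: le_trans (ler_normD _ _) _; rewrite normrM ger0_norm// /L; lra.
have h2 : (D2 t + N t - m) ^+ 2 <= L ^+ 2.
  apply: sqL; apply: le_trans (ler_normB _ _) _.
  have := ler_normD (D2 t) (N t); rewrite /L; lra.
have h3 : (sg b * nu) ^+ 2 <= L ^+ 2.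
  apply: sqL; rewrite normrM /sg; case: (b); rewrite ?normrN normr1 mul1r /L; lra.
have h4 : 1 <= L ^+ 2.
  have -> : (1 : R) = 1 ^+ 2 by rewrite expr1n.
  by rewrite !expr2 ler_pM// /L; lra.
have hD : (D t)^-1 ^+ 2 <= d0^-1 ^+ 2.
  have D0 : 0 <= (D t)^-1 by rewrite invr_ge0; lra.
  have : (D t)^-1 <= d0^-1 by rewrite lef_pV2// posrE; lra.
  by rewrite !expr2 => h; apply: ler_pM.
have fm : f b t ^+ 2 <= mass f t.
  by rewrite /mass; have := sqr_ge0 (f true t); have := sqr_ge0 (f false t); case: (b); lra.
have Qm : Q b t ^+ 2 <= mass Q t.
  by rewrite /mass; have := sqr_ge0 (Q true t); have := sqr_ge0 (Q false t); case: (b); lra.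
have Pm : P b t ^+ 2 + P (~~ b) t ^+ 2 = mass P t.
  by rewrite /mass; case: (b) => //=; rewrite addrC.
have k1 := ler_wpM2r (sqr_ge0 (Q b t)) h1.
have k2 := ler_wpM2r (sqr_ge0 (P b t)) h2.
have k3 := ler_wpM2r (sqr_ge0 (P (~~ b) t)) h3.
have k4 := ler_wpM2r (sqr_ge0 (f b t)) h4.
have four (p q r s : R) : (p - q - r - s) ^+ 2 <= 4 * (p ^+ 2 + q ^+ 2 + r ^+ 2 + s ^+ 2).
  rewrite -subr_ge0; set e := (X in 0 <= X).
  have -> : e = (p + q) ^+ 2 + (p + r) ^+ 2 + (p + s) ^+ 2 + (q - r) ^+ 2
     + (q - s) ^+ 2 + (r - s) ^+ 2 by rewrite /e; ring.
  by rewrite !addr_ge0 ?sqr_ge0.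
rewrite /second exprMn.
set X := (X in X ^+ 2 * _ <= _).
have hX : X ^+ 2 <= 4 * L ^+ 2 * (mass f t + mass P t + mass Q t).
  apply: le_trans (four _ _ _ _) _; rewrite !exprMn.
  have M1 := ler_wpM2l (sqr_ge0 L) fm; have M2 := ler_wpM2l (sqr_ge0 L) Qm.
  rewrite exprMn in k3.
  rewrite -Pm.
  lra.
have -> : 4 * (L / d0) ^+ 2 * (mass f t + mass P t + mass Q t) =
  4 * L ^+ 2 * (mass f t + mass P t + mass Q t) * d0^-1 ^+ 2 by rewrite exprMn; ring.
by apply: ler_pM => //; exact: sqr_ge0.
Qed.

(** The derivative of the flux is D |p'|^2 + Re (f conj p) - (D2 / 2 + N - m) |p|^2, the
    nu terms cancelling between the two components; Young's inequality absorbs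
    the term in f. *)
Lemma energy_branch x y d0 del K D D1 D2 N f P Q :
  x <= y -> 0 < d0 -> 0 < del -> 0 <= m ->
  branch x y d0 del K D D1 D2 N ->
  (forall b, itg x y (fun t => f b t ^+ 2)) ->
  solves x y D D1 D2 N f P Q ->
  segint x y (density d0 del P Q) - (2 * del)^-1 * segint x y (mass f) <=
  flux D D1 P Q y - flux D D1 P Q x.
Proof.
move=> xy d00 del0 m0 br hf hsol.
have [hD hD1 mN Dge neg bd] := br.
pose flux1 b t := (D t * Q b t + 2^-1 * (D1 t * P b t) + c / 2 * P b t) * P b t.
have pflux b := primitiveM xy (primitiveD (primitiveD
  (primitiveM xy hD (hsol b).2) (primitiveZ (2^-1) (primitiveM xy hD1 (hsol b).1)))
  (primitiveZ (c / 2) (hsol b).1)) (hsol b).1.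
have i1 : itg x y (density d0 del P Q).
  by apply: itg_density; move=> b; [exact: (hsol b).1|exact: (hsol b).2].
have i2 : itg x y (mass f) by apply: itgD.
rewrite -segintZ// -segintB//; last exact: itgZ.
have H := primitive_increment_le xy (primitiveD (pflux true) (pflux false)).
have -> : flux D D1 P Q y - flux D D1 P Q x =
  (flux1 true y + flux1 false y) - (flux1 true x + flux1 false x).
  by rewrite /flux /flux1; field.
apply: H; first by apply: itgB => //; exact: itgZ.
move=> t txy; have Dt := Dge t txy; have nt := neg t txy.
have y1 := young (P true t) (f true t) del0.
have y2 := young (P false t) (f false t) del0.
have D0 : D t != 0 by rewrite lt0r_neq0//; lra.
rewrite /second /density /mass /sg /=.
set r := (X in _ <= X).
have -> : r = D t * (Q true t ^+ 2 + Q false t ^+ 2)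
   + (P true t * f true t + P false t * f false t)
   - (D2 t / 2 + N t - m) * (P true t ^+ 2 + P false t ^+ 2).
  by rewrite /r; field.
have h1 : d0 * (Q true t ^+ 2 + Q false t ^+ 2) <=
    D t * (Q true t ^+ 2 + Q false t ^+ 2).
  by apply: ler_wpM2r => //; rewrite addr_ge0 ?sqr_ge0.
have h2 : (D2 t / 2 + N t - m) * (P true t ^+ 2 + P false t ^+ 2) <=
    - del * (P true t ^+ 2 + P false t ^+ 2).
  by apply: ler_wpM2r; [rewrite addr_ge0 ?sqr_ge0|lra].
lra.
Qed.

End energy.

(** * The energy estimate across the shock, shooting and existence *)

Section positivity.
Context {R : realType}.
Implicit Types (x y z s t : R) (f g : R -> R).

Lemma le_segint_subset x y s t f : (forall u, x <= u <= y -> 0 <= f u) ->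
  itg x y f -> x <= s -> s <= t -> t <= y -> segint s t f <= segint x y f.
Proof.
move=> f0 hf xs st ty.
rewrite (@segint_split _ x s y)//; last by lra.
rewrite (@segint_split _ s t y)//; last by apply: itgS hf _ _.
have h1 : 0 <= segint x s f by apply: segint_ge0 => u hu; apply: f0; lra.
have h2 : 0 <= segint t y f by apply: segint_ge0 => u hu; apply: f0; lra.
lra.
Qed.

Lemma segint_gt0 x y t0 f : x < y -> {within `[x, y], continuous f} ->
  (forall u, x <= u <= y -> 0 <= f u) -> x <= t0 <= y -> 0 < f t0 ->
  0 < segint x y f.
Proof.
move=> xy cf f0 t0xy ft0; have hf := itg_continuous cf.
have e0 : 0 < f t0 / 2 by lra.
have [d d0 dP] := within_continuousP cf t0xy e0.
pose s := Num.max x (t0 - d / 2); pose t := Num.min y (t0 + d / 2).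
have hs : x <= s /\ t0 - d / 2 <= s by rewrite !le_max !lexx orbT.
have ht : t <= y /\ t <= t0 + d / 2 by rewrite !ge_min !lexx orbT.
have st : s < t.
  by rewrite /s /t gt_max !lt_min; apply/andP; split; apply/andP; split; lra.
apply: (@lt_le_trans _ _ (segint s t f)); last by apply: le_segint_subset => //; lra.
apply: (@lt_le_trans _ _ (segint s t (fun=> f t0 / 2))).
  by rewrite segint_cst; [apply: mulr_gt0 => //; lra|lra].
apply: le_segint; [exact: itg_cst|by apply: itgS hf _ _; lra|].
move=> u su; have u1 : x <= u <= y by lra.
have u2 : t0 - d < u < t0 + d by lra.
by have := dP u u1 u2; rewrite ler_norml; lra.
Qed.

End positivity.

Section two_branches.
Context {R : realType}.
Implicit Types (x y z s t : R) (D N u : R -> R).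
Implicit Types (f P Q : bool -> R -> R) (b : bool).

Definition join (zs : R) (u v : R -> R) t : R := if t <= zs then u t else v t.

Variables (zs d0 del K c m nu : R).
Variables (DL D1L D2L NL DR D1R D2R NR : R -> R).
Hypotheses (zs0 : zs < 0) (d00 : 0 < d0) (del0 : 0 < del) (m0 : 0 <= m).
Hypothesis brL : forall x, x <= zs -> branch x zs d0 del K DL D1L D2L NL.
Hypothesis brR : branch zs 0 d0 del K DR D1R D2R NR.
Hypotheses (Dzs : DL zs = DR zs) (D1zs : D1L zs <= D1R zs).

Local Notation solvesJ x f P Q := (solves c m nu x 0
  (join zs DL DR) (join zs D1L D1R) (join zs D2L D2R) (join zs NL NR) f P Q).
Local Notation flx := (flux c DL D1L).

Lemma solves_left x f P Q : x <= zs -> solvesJ x f P Q ->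
  solves c m nu x zs DL D1L D2L NL f P Q.
Proof.
move=> xzs sol b; have [h1 h2] := sol b; split.
  exact: primitiveS h1 (lexx x) (ltW zs0).
apply: eq_primitive (primitiveS h2 (lexx x) (ltW zs0)) _ _ => //.
by move=> t /andP[_ tz]; rewrite /second /join tz.
Qed.

Lemma solves_right x f P Q : x <= zs -> solvesJ x f P Q ->
  solves c m nu zs 0 DR D1R D2R NR f P Q.
Proof.
move=> xzs sol b; have [h1 h2] := sol b; split.
  by apply: primitiveS h1 _ _.
apply: primitive_change_left (primitiveS h2 _ (lexx 0)) => //.
by move=> t /andP[zt _]; rewrite /second /join leNgt zt.
Qed.

(** At the shock the two fluxes differ by (D1R - D1L) |p|^2 / 2, which is
    nonnegative and may be dropped when the estimates on both sides are added. *)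
Lemma energy x f P Q : x <= zs -> (forall b, itg x 0 (fun t => f b t ^+ 2)) ->
  solvesJ x f P Q -> (forall b, P b 0 = 0) ->
  segint x 0 (density d0 del P Q) <=
  (2 * del)^-1 * segint x 0 (mass f) - flx P Q x.
Proof.
move=> xzs hf sol P0.
have eL := energy_branch xzs d00 del0 m0 (brL xzs) _ (solves_left xzs sol).
have {}eL := eL (fun b => itgS (hf b) (lexx x) (ltW zs0)).
have eR := energy_branch (ltW zs0) d00 del0 m0 brR _ (solves_right xzs sol).
have {}eR := eR (fun b => itgS (hf b) xzs (lexx 0)).
have jmp : flux c DL D1L P Q zs <= flux c DR D1R P Q zs.
  rewrite /flux Dzs -subr_ge0.
  set r := (X in 0 <= X).
  have -> : r = (D1R zs - D1L zs) / 2 * (P true zs ^+ 2 + P false zs ^+ 2).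
    by rewrite /r; ring.
  by apply: mulr_ge0; [have := D1zs; lra|rewrite addr_ge0 ?sqr_ge0].
have F0 : flux c DR D1R P Q 0 = 0 by rewrite /flux !P0 !mulr0 addr0.
have i1 : itg x 0 (density d0 del P Q).
  by apply: itg_density; move=> b; [exact: (sol b).1|exact: (sol b).2].
have i2 : itg x 0 (mass f) by apply: itgD.
rewrite (segint_split i1 xzs (ltW zs0)) (segint_split i2 xzs (ltW zs0)).
rewrite mulrDr; lra.
Qed.

Lemma norm_flux_le x P Q : x <= zs ->
  `|flx P Q x| <= (2 * K + `|c|) * (mass P x + mass Q x).
Proof.
move=> xzs; have [|DK D1K _ _] := branch_bound (brL xzs) (t := x).
  by rewrite lexx.
have one (p q : R) : `|(DL x * q + D1L x / 2 * p + c / 2 * p) * p| <=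
    (2 * K + `|c|) * (p ^+ 2 + q ^+ 2).
  rewrite normrM -(real_normK (num_real p)) -(real_normK (num_real q)).
  have h : `|DL x * q + D1L x / 2 * p + c / 2 * p| <=
      K * `|q| + (K + `|c|) * `|p|.
    apply: le_trans (ler_normD _ _) _.
    apply: (@le_trans _ _ (`|DL x| * `|q| + `|D1L x| * `|p| + `|c| * `|p|)).
      apply: lerD; last first.
        rewrite !normrM; apply: ler_wpM2r => //.
        by rewrite [X in _ * X]ger0_norm ?invr_ge0// ler_piMr// invf_le1 ?ler1n.
      apply: le_trans (ler_normD _ _) _; rewrite !normrM; apply: lerD => //.
      apply: ler_wpM2r => //.
      by rewrite [X in _ * X]ger0_norm ?invr_ge0// ler_piMr// invf_le1 ?ler1n.
    have h1 : `|DL x| * `|q| <= K * `|q| by apply: ler_wpM2r.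
    have h2 : `|D1L x| * `|p| <= K * `|p| by apply: ler_wpM2r.
    lra.
  have p0 := normr_ge0 p; have q0 := normr_ge0 q; have c0 := normr_ge0 c.
  have K0 : 0 <= K by apply: le_trans DK.
  apply: (@le_trans _ _ ((K * `|q| + (K + `|c|) * `|p|) * `|p|)).
    exact: ler_wpM2r.
  have h1 : 0 <= K * (`|q| - `|p|) ^+ 2 by rewrite mulr_ge0 ?sqr_ge0.
  have h2 : 0 <= K * `|q| ^+ 2 by rewrite mulr_ge0 ?sqr_ge0.
  have h3 : 0 <= K * `|p| ^+ 2 by rewrite mulr_ge0 ?sqr_ge0.
  have h4 : 0 <= `|c| * `|q| ^+ 2 by rewrite mulr_ge0 ?sqr_ge0.
  rewrite -subr_ge0.
  have -> : (2 * K + `|c|) * (`|p| ^+ 2 + `|q| ^+ 2) -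
      (K * `|q| + (K + `|c|) * `|p|) * `|p| =
    2^-1 * (K * (`|q| - `|p|) ^+ 2) + 3 / 2 * (K * `|q| ^+ 2)
    + 2^-1 * (K * `|p| ^+ 2) + `|c| * `|q| ^+ 2 by field.
  lra.
rewrite /flux; apply: le_trans (ler_normD _ _) _.
apply: le_trans (lerD (one _ _) (one _ _)) _.
by rewrite -mulrDr /mass le_eqVlt; apply/orP; left; apply/eqP; ring.
Qed.

Lemma continuous_mass x P F : (forall b, primitive x 0 (P b) (F b)) ->
  {within `[x, 0], continuous (mass P)}.
Proof.
move=> hP; have cP b : {within `[x, 0], continuous (P b)}.
  exact: primitive_continuous (hP b).
move=> t.
by apply: cvgD; rewrite /= expr2; apply: cvgM; exact: cP.
Qed.

Lemma continuous_density x P Q F G : (forall b, primitive x 0 (P b) (F b)) ->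
  (forall b, primitive x 0 (Q b) (G b)) ->
  {within `[x, 0], continuous (density d0 del P Q)}.
Proof.
move=> hP hQ; have cP := continuous_mass hP; have cQ := continuous_mass hQ.
by move=> t; apply: cvgD; apply: cvgM; [exact: cvg_cst|exact: cQ|
  exact: cvg_cst|exact: cP].
Qed.

Lemma mass_ge0 f t : 0 <= mass f t :> R.
Proof. by rewrite addr_ge0 ?sqr_ge0. Qed.

Lemma density_ge0 P Q t : 0 <= density d0 del P Q t.
Proof.
by apply: addr_ge0; apply: mulr_ge0; rewrite ?addr_ge0 ?sqr_ge0 ?divr_ge0// ltW.
Qed.

(** A nonzero energy would force the boundary term, hence the solution, to stay
   away from zero all the way to minus infinity. *)
Lemma bounded_homogeneous_eq0 P Q B :
  (forall x, x <= 0 -> solvesJ x (fun _ _ => 0) P Q) -> (forall b, P b 0 = 0) ->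
  (forall x, x <= 0 -> segint x 0 (fun t => mass P t + mass Q t) <= B) ->
  forall b t, t <= 0 -> P b t = 0.
Proof.
have [zs0' del0'] := (zs0, del0).
move=> sol P0 hB.
have id x : x <= 0 -> itg x 0 (density d0 del P Q).
  move=> x0; apply: itg_density; move=> b.
    exact: (sol x x0 b).1.
  exact: (sol x x0 b).2.
have im x : x <= 0 -> itg x 0 (fun t => mass P t + mass Q t).
  move=> x0; apply: itgD; apply: itg_continuous.
    exact: (continuous_mass (fun b => (sol x x0 b).1)).
  exact: (continuous_mass (fun b => (sol x x0 b).2)).
have K0 : 0 <= 2 * K + `|c|.
  have [|DK _ _ _] := branch_bound (brL (lexx zs)) (t := zs); first by rewrite lexx.
  by have := normr_ge0 c; have := normr_ge0 (DL zs); lra.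
pose k := 2 * K + `|c| + 1; have k0 : 0 < k by rewrite /k; lra.
have I0 x : x <= zs -> segint x 0 (density d0 del P Q) <= 0.
  move=> xzs; rewrite leNgt; apply/negP; set I := segint _ _ _ => I0.
  have lowW y : y <= x -> I / k <= mass P y + mass Q y.
    move=> yx; have yzs : y <= zs by lra.
    have y0 : y <= 0 by lra.
    have h0 := @energy y (fun _ _ => 0) P Q yzs _ (sol y y0) P0.
    have := h0 (fun b => itg_cst y 0 (0 ^+ 2)).
    have -> : segint y 0 (mass (fun _ _ => 0)) = 0 :> R.
      rewrite (@eq_segint _ _ _ _ (fun=> 0)); last first.
        by move=> t _; rewrite /mass expr0n /= addr0.
      by rewrite segint_cst// mul0r.
    have Iy : I <= segint y 0 (density d0 del P Q).
      apply: le_segint_subset; [by move=> *; exact: density_ge0|exact: id|lra..].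
    have := norm_flux_le P Q yzs.
    rewrite mulr0 sub0r ler_pdivrMr// ler_norml => /andP[h1 _] h2.
    have h3 := mass_ge0 P y; have h4 := mass_ge0 Q y.
    have -> : (mass P y + mass Q y) * k = (2 * K + `|c|) * (mass P y + mass Q y) +
      (mass P y + mass Q y) by rewrite /k; ring.
    lra.
  have Ik : 0 < I / k by exact: divr_gt0.
  (* mass P + mass Q is at least I / k on [y, x], hence has integral at least
     |B| + 1 there *)
  pose y := x - (`|B| + 1) / (I / k).
  have yx : y <= x.
    rewrite /y; have : 0 <= (`|B| + 1) / (I / k) by rewrite divr_ge0// ?ltW//; lra.
    lra.
  have y0 : y <= 0 by lra.
  have /le_trans/(_ (hB y y0)) : segint y x (fun t => mass P t + mass Q t) <=
      segint y 0 (fun t => mass P t + mass Q t).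
    apply: le_segint_subset; [by move=> *; rewrite addr_ge0// mass_ge0|exact: im|lra..].
  have : segint y x (fun=> I / k) <= segint y x (fun t => mass P t + mass Q t).
    apply: le_segint; [exact: itg_cst|by apply: itgS (im y y0) _ _; lra|].
    by move=> t ty; apply: lowW; lra.
  rewrite segint_cst// /y opprB addrC subrK mulrC divfK ?lt0r_neq0//.
  by have := ler_norm B; lra.
move=> b t t0; pose x := Num.min t zs - 1.
have [xt xzs] : x <= t /\ x <= zs.
  have h1 : Num.min t zs <= t by rewrite ge_min lexx.
  have h2 : Num.min t zs <= zs by rewrite ge_min lexx orbT.
  by rewrite /x; lra.
have x0 : x < 0 by lra.
apply/eqP; apply: contraT => Pt; have := I0 x xzs; rewrite leNgt => /negP[].
apply: (@segint_gt0 _ _ _ t _ x0).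
- by apply: continuous_density => b'; [exact: (sol x (ltW x0) b').1|
    exact: (sol x (ltW x0) b').2].
- by move=> *; exact: density_ge0.
- by rewrite xt.
- rewrite /density; apply: ltr_wpDl; first by rewrite mulr_ge0 ?addr_ge0 ?sqr_ge0// ltW.
  apply: mulr_gt0; first by lra.
  have P2 : 0 < P b t ^+ 2 by rewrite exprn_even_gt0.
  by case: b Pt P2 => _ P2; [apply: ltr_wpDr|apply: ltr_wpDl]; rewrite ?sqr_ge0.
Qed.

Definition datum (f : bool -> R -> R) (M : R) : Prop :=
  (forall b x, x <= 0 -> measurable_fun `[x, 0] (f b) /\
     itg x 0 (fun t => f b t ^+ 2)) /\
  forall x, x <= 0 -> segint x 0 (mass f) <= M.

Lemma itg_bounded x y (M : R) (u : R -> R) : measurable_fun `[x, y] u ->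
  (forall t, x <= t <= y -> `|u t| <= M) -> itg x y u.
Proof.
move=> mu uM; apply: eq_itg (itgMl (itg_cst x y 1) mu uM) => t _.
by rewrite mul1r.
Qed.

Lemma itg_second x y D D1 D2 N f P Q b : branch x y d0 del K D D1 D2 N ->
  itg x y (f b) ->
  (forall b, measurable_fun `[x, y] (P b) /\
     exists M : R, forall t, x <= t <= y -> `|P b t| <= M) ->
  (measurable_fun `[x, y] (Q b) /\
     exists M : R, forall t, x <= t <= y -> `|Q b t| <= M) ->
  itg x y (second c m nu D D1 D2 N f P Q b).
Proof.
move=> [hD hD1 mN Dge _ bd] fb hP [mQ [MQ bQ]].
have [mP [MP bP]] := hP b; have [mP' [MP' bP']] := hP (~~ b).
have iQ := itg_bounded mQ bQ; have iP := itg_bounded mP bP.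
have iP' := itg_bounded mP' bP'.
apply: (@itgMl _ _ _ d0^-1).
- apply: itgB; first apply: itgB; first apply: itgB => //.
  + apply: eq_itg (itgD (itgZ 2 (itgMl iQ (primitive_meas hD1) _)) (itgZ c iQ)).
      by move=> t _ /=; ring.
    by move=> t ht; have [_ h _ _] := bd t ht; exact: h.
  + apply: eq_itg (itgD (itgMl iP (itg_meas hD1.1) _)
      (itgB (itgMl iP mN _) (itgZ m iP))).
    * by move=> t _ /=; ring.
    * by move=> t ht; have [_ _ h _] := bd t ht; exact: h.
    * by move=> t ht; have [_ _ _ h] := bd t ht; exact: h.
  + exact: itgZ.
- exact: continuous_inv_meas d00 (primitive_continuous hD) Dge.
- move=> t ht; have Dt := Dge t ht; have d0' := d00.
  rewrite normfV ger0_norm; last by lra.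
  by rewrite lef_pV2// posrE; lra.
Qed.

Lemma datum_itg f M x b : datum f M -> x <= 0 -> itg x 0 (f b).
Proof. by move=> [h _] x0; have [mf f2] := h b x x0; exact: itg_sqr. Qed.

Lemma itg_second_join x f P Q b : x <= 0 -> itg x 0 (f b) ->
  (forall b, measurable_fun `[x, 0] (P b) /\
     exists M : R, forall t, x <= t <= 0 -> `|P b t| <= M) ->
  (measurable_fun `[x, 0] (Q b) /\
     exists M : R, forall t, x <= t <= 0 -> `|Q b t| <= M) ->
  itg x 0 (second c m nu (join zs DL DR) (join zs D1L D1R) (join zs D2L D2R)
    (join zs NL NR) f P Q b).
Proof.
move=> x0 hf hP hQ.
have sub s t (v : R -> R) : x <= s -> t <= 0 -> (measurable_fun `[x, 0] v /\
     exists M : R, forall w, x <= w <= 0 -> `|v w| <= M) ->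
   measurable_fun `[s, t] v /\ exists M : R, forall w, s <= w <= t -> `|v w| <= M.
  move=> xs t0 [mv [M vM]]; split.
    by apply: measurable_funS mv => //; apply: subset_itv; rewrite bnd_simp.
  by exists M => w hw; apply: vM; lra.
have right s : zs <= s -> x <= s -> itg s 0 (second c m nu (join zs DL DR)
    (join zs D1L D1R) (join zs D2L D2R) (join zs NL NR) f P Q b).
  move=> zss xs.
  apply: (@itg_change_left _ _ _ (second c m nu DR D1R D2R NR f P Q b)).
    move=> t /andP[st _].
    by rewrite /second /join leNgt (le_lt_trans zss st).
  apply: itg_second (branchS brR zss (lexx 0)) _ _ _.
  - exact: itgS hf xs (lexx 0).
  - by move=> b'; exact: sub xs (lexx 0) (hP b').
  - exact: sub xs (lexx 0) hQ.
have [zx|xz] := leP zs x; first exact: right.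
apply: (@itg_glue _ _ zs); [exact: ltW|exact: ltW| |by apply: right => //; exact: ltW].
apply: (@eq_itg _ _ _ (second c m nu DL D1L D2L NL f P Q b)).
  by move=> t /andP[_ tz]; rewrite /second /join tz.
apply: itg_second (brL (ltW xz)) _ _ _.
- exact: itgS hf (lexx x) (ltW zs0).
- by move=> b'; exact: sub (lexx x) (ltW zs0) (hP b').
- exact: sub (lexx x) (ltW zs0) hQ.
Qed.

Lemma second_join_sqr_le f P Q b t : t <= 0 ->
  second c m nu (join zs DL DR) (join zs D1L D1R) (join zs D2L D2R)
    (join zs NL NR) f P Q b t ^+ 2 <=
  4 * ((1 + 4 * K + `|c| + `|m| + `|nu|) / d0) ^+ 2 *
    (mass f t + mass P t + mass Q t).
Proof.
move=> t0; have [tz|zt] := leP t zs.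
  have := second_sqr_le c m nu f P Q b (brL tz) d00 (t := t).
  by rewrite lexx tz /second /join tz; apply.
have := second_sqr_le c m nu f P Q b brR d00 (t := t).
rewrite (ltW zt) t0 /second /join; have -> : (t <= zs) = false by rewrite leNgt zt.
exact.
Qed.

Lemma join_branch_bounds (Phi : R -> R -> R -> R -> Prop) :
  (forall D D1 D2 N x y t, branch x y d0 del K D D1 D2 N -> x <= t <= y ->
     Phi (D t) (D1 t) (D2 t) (N t)) ->
  forall t, t <= 0 -> Phi (join zs DL DR t) (join zs D1L D1R t)
    (join zs D2L D2R t) (join zs NL NR t).
Proof.
move=> h t t0; rewrite /join; have [tz|zt] := leP t zs.
  by apply: h (brL tz) _; rewrite lexx tz.
by apply: h brR _; rewrite (ltW zt).
Qed.

Lemma initial_value f M (q : bool -> R) : datum f M -> exists P Q : bool -> R -> R,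
  (forall b, P b 0 = 0 /\ Q b 0 = q b) /\ forall x, x <= 0 -> solvesJ x f P Q.
Proof.
move=> df; have [zs0' d00'] := (zs0, d00).
(* the unknown of index (b, false) is p_b, the one of index (b, true) is p_b' *)
pose F (i : bool * bool) t (y : bool * bool -> R) : R :=
  if i.2 then second c m nu (join zs DL DR) (join zs D1L D1R) (join zs D2L D2R)
    (join zs NL NR) f (fun b _ => y (b, false)) (fun b _ => y (b, true)) i.1 t
  else y (i.1, true).
have [_ fM] := df.
have M0 : 0 <= M by apply: le_trans (fM 0 _) => //; rewrite segint_pt.
have K0 : 0 <= K.
  have [|DK _ _ _] := branch_bound (brL (lexx zs)) (t := zs); first by rewrite lexx.
  by apply: le_trans DK.
pose L := (4 * K + `|c| + `|m| + `|nu|) / d0.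
have L0 : 0 <= L by rewrite divr_ge0 ?addr_ge0 ?mulr_ge0// ltW.
have Dinv t : t <= 0 -> 0 < (join zs DL DR t)^-1 <= d0^-1.
  move: t; apply: (join_branch_bounds (Phi := fun e _ _ _ => 0 < e^-1 <= d0^-1)).
  move=> D D1 D2 N x y t br txy; have Dt := branch_ge br txy.
  by rewrite invr_gt0 lef_pV2 ?posrE//; lra.
have itgF i x (y : bool * bool -> R -> R) :
    (forall j, measurable_fun `[x, 0] (y j) /\
      exists M : R, forall t, x <= t <= 0 -> `|y j t| <= M) ->
    itg x 0 (fun z => F i z (y^~ z)).
  case: i => [b e] hy; rewrite /F /=.
  have [x0|x0] := ltP 0 x.
    apply: eq_itg (itg_cst x 0 0) => t; lra.
  case: e; last by have [my [N yN]] := hy (b, true); exact: itg_bounded my yN.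
  apply: (@itg_second_join x f (fun b t => y (b, false) t) (fun b t => y (b, true) t)).
  - exact: x0.
  - exact: datum_itg df x0.
  - by move=> b'; exact: hy.
  - exact: hy.
have [|||||y hy] := @caratheodory_exists R _ F (fun i => if i.2 then q i.1 else 0)
  (1 + L) (`|q true| + `|q false|) (d0^-1 * (1 + M)).
- lra.
- move=> [b e] t y y' B t0 yB; have B0 : 0 <= B by apply: le_trans (yB (b, e)).
  rewrite /F /=; case: e; last first.
    by apply: le_trans (yB _) _; rewrite ler_peMl//; lra.
  rewrite /second -mulrBl normrM.
  have /andP[i0 i1] := Dinv t t0; rewrite (gtr0_norm i0).
  apply: (@le_trans _ _ ((4 * K + `|c| + `|m| + `|nu|) * B * d0^-1)); last first.
    rewrite mulrAC -/L; apply: ler_wpM2r => //; lra.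
  apply: ler_pM => //; first exact: ltW.
  have := join_branch_bounds (Phi := fun e e1 e2 n =>
    [/\ `|e| <= K, `|e1| <= K, `|e2| <= K & `|n| <= K])
    (fun _ _ _ _ _ _ _ br => branch_bound br (t := _)) t0.
  move=> [_ k1 k2 k3].
  set d1 := join _ D1L _ _; set d2 := join _ D2L _ _; set n := join _ NL _ _.
  set Y := (X in `|X| <= _).
  have -> : Y = - ((2 * d1 + c) * (y (b, true) - y' (b, true)))
    - (d2 + n - m) * (y (b, false) - y' (b, false))
    - sg b * nu * (y (~~ b, false) - y' (~~ b, false)) by rewrite /Y; ring.
  apply: le_trans (ler_normB _ _) _.
  apply: (@le_trans _ _ ((2 * K + `|c|) * B + (2 * K + `|m|) * B + `|nu| * B)); last first.
    by rewrite le_eqVlt; apply/orP; left; apply/eqP; ring.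
  apply: lerD; last first.
    rewrite normrM; apply: ler_pM => //; rewrite normrM /sg.
    by case: (b); rewrite ?normrN normr1 mul1r.
  apply: le_trans (ler_normB _ _) _; rewrite normrN; apply: lerD.
    rewrite normrM; apply: ler_pM => //.
    apply: le_trans (ler_normD _ _) _; rewrite lerD2r normrM ger0_norm//.
    by rewrite ler_wpM2l.
  rewrite normrM; apply: ler_pM => //.
  apply: le_trans (ler_normB _ _) _; rewrite lerD2r.
  by apply: le_trans (ler_normD _ _) _; lra.
- exact: itgF.
- by move=> [[] []] /=; rewrite ?normr0 ?addr_ge0// ?lerDl ?lerDr.
- move=> [b e] z z0; rewrite /F /=.
  have E1 : 1 <= expR (- z) by rewrite -[leLHS]expR0 ler_expR oppr_ge0.
  have Ez : - z <= expR (- z) by have := expR_ge1Dx (- z); lra.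
  have d0V : 0 <= d0^-1 by rewrite invr_ge0 ltW.
  case: e; last first.
    rewrite segint_cst// mul0r normr0.
    by rewrite !mulr_ge0 ?addr_ge0// expR_ge0.
  have i1 : itg z 0 (fun s => F (b, true) s (fun=> 0)).
    apply: (itgF (b, true) z (fun _ _ => 0)) => j; split=> //.
    by exists 0 => t _; rewrite normr0.
  have i2 : itg z 0 (mass f) by apply: itgD; apply: (df.1 _ z z0).2.
  have i3 : itg z 0 (fun t => 1 + mass f t) by apply: itgD => //; exact: itg_cst.
  apply: le_trans (norm_segint i1) _.
  apply: (@le_trans _ _ (segint z 0 (fun t => d0^-1 * (1 + mass f t)))).
    apply: le_segint; [exact: itg_norm i1|exact: itgZ|].
    move=> t tz; rewrite /F /second /= !mulr0 !subr0 normrM mulrC.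
    have /andP[k1 k2] := Dinv t (proj2 (andP tz)).
    rewrite (gtr0_norm k1); apply: ler_pM => //; first exact: ltW.
    have : `|f b t| <= 1 + f b t ^+ 2.
      by rewrite -(real_normK (num_real (f b t))); nra.
    rewrite /mass; have := sqr_ge0 (f true t); have := sqr_ge0 (f false t).
    by case: (b); lra.
  rewrite segintZ// -mulrA; apply: ler_wpM2l => //.
  rewrite segintD//; last exact: itg_cst.
  rewrite segint_cst// mul1r sub0r mulrDl mul1r; apply: lerD => //.
  by apply: le_trans (fM z z0) _; rewrite ler_peMr.
exists (fun b => y (b, false)), (fun b => y (b, true)); split.
  by move=> b; split; [exact: (hy (b, false)).1|exact: (hy (b, true)).1].
move=> x x0 b; split; first exact: ((hy (b, false)).2 x x0).
exact: ((hy (b, true)).2 x x0).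
Qed.

(** The complex combination P + (k1 + i k2) H, in real and imaginary parts. *)
Definition comb (k1 k2 : R) (P H : bool -> R -> R) b t : R :=
  P b t + (k1 * H b t - sg b * k2 * H (~~ b) t).

Lemma primitive_comb x y k1 k2 P Q H G :
  (forall b, primitive x y (P b) (Q b)) -> (forall b, primitive x y (H b) (G b)) ->
  forall b, primitive x y (comb k1 k2 P H b) (comb k1 k2 Q G b).
Proof.
move=> hP hH b.
have h := primitiveD (hP b) (primitiveD (primitiveZ k1 (hH b))
  (primitiveZ (- (sg b * k2)) (hH (~~ b)))).
by apply: eq_primitive h _ _ => t _; rewrite /comb mulNr.
Qed.

Lemma solves_comb x k1 k2 f P Q H G : solvesJ x f P Q ->
  solvesJ x (fun _ _ => 0) H G ->
  solvesJ x f (comb k1 k2 P H) (comb k1 k2 Q G).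
Proof.
move=> sP sH b; split.
  by apply: primitive_comb => b'; [exact: (sP b').1|exact: (sH b').1].
have h := primitive_comb k1 k2 (fun b => (sP b).2) (fun b => (sH b).2) b.
apply: eq_primitive h _ _ => // t _.
by rewrite /second /comb /sg; case: b => /=; ring.
Qed.

(** Parallelogram inequality: energies depend on the coefficients continuously. *)
Lemma density_comb_le k1 k2 l1 l2 P Q H G t :
  density d0 del (comb l1 l2 P H) (comb l1 l2 Q G) t <=
  2 * density d0 del (comb k1 k2 P H) (comb k1 k2 Q G) t +
  2 * ((l1 - k1) ^+ 2 + (l2 - k2) ^+ 2) * density d0 del H G t.
Proof.
have key (pt pf ht hf : R) :
    (pt + (l1 * ht - 1 * l2 * hf)) ^+ 2 + (pf + (l1 * hf - -1 * l2 * ht)) ^+ 2 <=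
    2 * ((pt + (k1 * ht - 1 * k2 * hf)) ^+ 2 + (pf + (k1 * hf - -1 * k2 * ht)) ^+ 2)
    + 2 * ((l1 - k1) ^+ 2 + (l2 - k2) ^+ 2) * (ht ^+ 2 + hf ^+ 2).
  rewrite -subr_ge0.
  set r := (X in 0 <= X).
  have -> : r = (pt + ((2 * k1 - l1) * ht - (2 * k2 - l2) * hf)) ^+ 2
     + (pf + ((2 * k1 - l1) * hf + (2 * k2 - l2) * ht)) ^+ 2 by rewrite /r; ring.
  by rewrite addr_ge0 ?sqr_ge0.
rewrite /density /comb /sg /=.
have h1 := key (P true t) (P false t) (H true t) (H false t).
have h2 := key (Q true t) (Q false t) (G true t) (G false t).
have e1 : 0 <= del / 2 by rewrite divr_ge0// ltW.
move: (ler_wpM2l (ltW d00) h2) (ler_wpM2l e1 h1).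
lra.
Qed.

(** The energies of P and of P + kappa H bound kappa, as that of H is positive. *)
Lemma density_leading_le k1 k2 P Q H G t :
  (k1 ^+ 2 + k2 ^+ 2) * density d0 del H G t <=
  2 * density d0 del (comb k1 k2 P H) (comb k1 k2 Q G) t + 2 * density d0 del P Q t.
Proof.
have key (pt pf ht hf : R) :
    (k1 ^+ 2 + k2 ^+ 2) * (ht ^+ 2 + hf ^+ 2) <=
    2 * ((pt + (k1 * ht - 1 * k2 * hf)) ^+ 2 + (pf + (k1 * hf - -1 * k2 * ht)) ^+ 2)
    + 2 * (pt ^+ 2 + pf ^+ 2).
  rewrite -subr_ge0.
  set r := (X in 0 <= X).
  have -> : r = (2 * pt + (k1 * ht - k2 * hf)) ^+ 2
     + (2 * pf + (k1 * hf + k2 * ht)) ^+ 2 by rewrite /r; ring.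
  by rewrite addr_ge0 ?sqr_ge0.
rewrite /density /comb /sg /=.
have h1 := key (P true t) (P false t) (H true t) (H false t).
have h2 := key (Q true t) (Q false t) (G true t) (G false t).
have e1 : 0 <= del / 2 by rewrite divr_ge0// ltW.
move: (ler_wpM2l (ltW d00) h2) (ler_wpM2l e1 h1).
lra.
Qed.

Lemma solves_itg_density x f P Q : solvesJ x f P Q -> itg x 0 (density d0 del P Q).
Proof.
by move=> sol; apply: itg_density => b; [exact: (sol b).1|exact: (sol b).2].
Qed.

Lemma density_segint_gt0 x f P Q : x < 0 -> solvesJ x f P Q -> Q true 0 = 1 ->
  0 < segint x 0 (density d0 del P Q).
Proof.
move=> x0 sol Q0; apply: (@segint_gt0 _ _ _ 0 _ x0).
- by apply: continuous_density => b; [exact: (sol b).1|exact: (sol b).2].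
- by move=> t _; exact: density_ge0.
- by rewrite lexx ltW.
- rewrite /density Q0 expr1n; apply: ltr_wpDr.
    by rewrite mulr_ge0 ?addr_ge0 ?sqr_ge0 ?divr_ge0// ltW.
  by apply: mulr_gt0 => //; apply: ltr_wpDr; rewrite ?sqr_ge0.
Qed.

(** H(x) is nonzero, for otherwise its flux at x would vanish and with it its energy;
    so kappa can be chosen to make P + kappa H vanish at x. *)
Lemma shooting f M P Q H G : datum f M ->
  (forall b, P b 0 = 0) -> (forall x, x <= 0 -> solvesJ x f P Q) ->
  (forall b, H b 0 = 0) -> G true 0 = 1 ->
  (forall x, x <= 0 -> solvesJ x (fun _ _ => 0) H G) ->
  forall x, x <= zs -> exists k1 k2 : R,
    segint x 0 (density d0 del (comb k1 k2 P H) (comb k1 k2 Q G)) <=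
    (2 * del)^-1 * M.
Proof.
have [zs0' del0'] := (zs0, del0).
move=> [df dM] P0 sP H0 G0 sH x xzs; have x0 : x < 0 by lra.
have h0 : segint x 0 (mass (fun _ _ => 0)) = 0 :> R.
  rewrite (@eq_segint _ _ _ _ (fun=> 0)); last first.
    by move=> t _; rewrite /mass expr0n /= addr0.
  by rewrite segint_cst ?mul0r// ltW.
pose w := mass H x.
have w0 : w != 0.
  apply/eqP => w0.
  have /andP[/eqP Ht /eqP Hf] : (H true x == 0) && (H false x == 0).
    rewrite -[H true x == 0]sqrf_eq0 -[H false x == 0]sqrf_eq0.
    by rewrite -paddr_eq0 ?sqr_ge0//; apply/eqP.
  have := energy xzs (fun _ => itg_cst x 0 (0 ^+ 2)) (sH x (ltW x0)) H0.
  rewrite h0 mulr0 /flux Ht Hf !mulr0 addr0 subr0 leNgt => /negP; apply.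
  exact: density_segint_gt0 x0 (sH x (ltW x0)) G0.
pose k1 := - (P true x * H true x + P false x * H false x) / w.
pose k2 := - (P false x * H true x - P true x * H false x) / w.
exists k1, k2.
have sol := solves_comb k1 k2 (sP x (ltW x0)) (sH x (ltW x0)).
have hx b : comb k1 k2 P H b x = 0.
  by move: w0; rewrite /comb /k1 /k2 /sg /w /mass => w0; case: b => /=; field.
have h00 b : comb k1 k2 P H b 0 = 0 by rewrite /comb P0 !H0; ring.
have := energy xzs (fun b => (df b x (ltW x0)).2) sol h00.
rewrite /flux !hx !mulr0 addr0 subr0 => /le_trans; apply.
by apply: ler_wpM2l; [rewrite invr_ge0; lra|apply: dM; exact: ltW].
Qed.

(** The coefficients kappa obtained by shooting from zs - n are bounded, and any of
    their cluster points yields a solution with bounded energy on the half line. *)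
Lemma existence f M : datum f M -> exists P Q : bool -> R -> R,
  [/\ forall b, P b 0 = 0, forall x, x <= 0 -> solvesJ x f P Q &
      forall x, x <= 0 -> segint x 0 (density d0 del P Q) <= M / del].
Proof.
have [zs0' del0'] := (zs0, del0).
move=> df.
have [P [Q [PQ0 sP]]] := initial_value (fun=> 0) df.
have d0' : datum (fun _ _ => 0 : R) 0.
  split=> [b x x0|x x0].
    by split; [exact: measurable_cst|exact: itg_cst].
  rewrite (@eq_segint _ _ _ _ (fun=> 0)); last first.
    by move=> t _; rewrite /mass expr0n /= addr0.
  by rewrite segint_cst ?mul0r.
have [H [G [HG0 sH]]] := initial_value (fun b => if b then 1 else 0) d0'.
have P0 b := (PQ0 b).1; have H0 b := (HG0 b).1; have G0 := (HG0 true).2.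
pose B := (2 * del)^-1 * M.
have iJ k1 k2 x : x <= 0 -> itg x 0 (density d0 del (comb k1 k2 P H) (comb k1 k2 Q G)).
  by move=> x0; exact: solves_itg_density (solves_comb k1 k2 (sP x x0) (sH x x0)).
have iH x : x <= 0 -> itg x 0 (density d0 del H G).
  by move=> x0; exact: solves_itg_density (sH x x0).
have iP x : x <= 0 -> itg x 0 (density d0 del P Q).
  by move=> x0; exact: solves_itg_density (sP x x0).
have shoot (n : nat) : exists k : R * R,
    segint (zs - n%:R) 0 (density d0 del (comb k.1 k.2 P H) (comb k.1 k.2 Q G)) <= B.
  have n0 : 0 <= n%:R :> R by [].
  have [|k1 [k2 hk]] := shooting df P0 sP H0 G0 sH (x := zs - n%:R); first by lra.
  by exists (k1, k2).
pose k n := projT1 (choice shoot) n.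
have hk (n : nat) x : zs - n%:R <= x -> x <= 0 ->
    segint x 0 (density d0 del (comb (k n).1 (k n).2 P H) (comb (k n).1 (k n).2 Q G)) <= B.
  move=> nx x0; apply: le_trans (projT2 (choice shoot) n).
  have n0 : 0 <= n%:R :> R by [].
  apply: le_segint_subset; [|by apply: iJ; lra|exact: nx|exact: x0|exact: lexx].
  by move=> t _; exact: density_ge0.
pose J := segint zs 0 (density d0 del H G).
have J0 : 0 < J by exact: density_segint_gt0 zs0 (sH zs (ltW zs0)) G0.
pose S := (2 * B + 2 * segint zs 0 (density d0 del P Q)) / J.
have kS n : (k n).1 ^+ 2 + (k n).2 ^+ 2 <= S.
  rewrite ler_pdivlMr//.
  have zs1 := ltW zs0.
  apply: (@le_trans _ _ (2 * segint zs 0 (density d0 del (comb (k n).1 (k n).2 P H)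
      (comb (k n).1 (k n).2 Q G)) + 2 * segint zs 0 (density d0 del P Q))); last first.
    rewrite lerD2r ler_pM2l//; apply: hk => //.
    by rewrite gerBl.
  rewrite -!segintZ; [|exact: iH|exact: iP|exact: iJ].
  rewrite -segintD; [|by apply: itgZ; exact: iJ|by apply: itgZ; exact: iP].
  apply: le_segint; [by apply: itgZ; exact: iH| |].
    by apply: itgD; apply: itgZ; [exact: iJ|exact: iP].
  by move=> t _; exact: density_leading_le.
pose L := S + 1.
have kL n : (`[- L, L] `*` `[- L, L])%classic (k n).
  have := kS n; have h1 := sqr_ge0 (k n).1; have h2 := sqr_ge0 (k n).2.
  by move=> h; split; rewrite /= in_itv/= /L; apply/andP; split; nra.
have cpt : compact (`[- L, L] `*` `[- L, L])%classic.
  by apply: compact_setX; exact: segment_compact.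
have [|l [_ lP]] := cpt (k @ \oo) _.
  by exists 0%N => // n _; exact: kL.
exists (comb l.1 l.2 P H), (comb l.1 l.2 Q G); split.
- by move=> b; rewrite /comb P0 !H0; ring.
- by move=> x x0; exact: solves_comb (sP x x0) (sH x x0).
move=> x x0.
have -> : M / del = 2 * B by rewrite /B; field; rewrite lt0r_neq0.
apply/ler_addgt0Pr => e e0.
pose JJ := segint x 0 (density d0 del H G).
have JJ0 : 0 <= JJ by apply: segint_ge0 => *; exact: density_ge0.
(* a radius around the cluster point small enough for 4 r JJ <= e *)
pose r := Num.min 1 (e / (4 * JJ + 1)).
have r0 : 0 < r by rewrite lt_min ltr01 divr_gt0//; lra.
have [N xN] : exists N : nat, zs - x <= N%:R.
  exists (Num.truncn `|zs - x|).+1.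
  apply: le_trans (ler_norm _) _; apply: ltW.
  by have /andP[_] := truncn_itv (normr_ge0 (zs - x)).
have [q [[n /= Nn <-] [b1 b2]]] := lP [set k n | n in [set n | (N <= n)%N]]
  (ball l r) (ex_intro2 _ _ N I (fun n hn => ex_intro2 _ _ n hn erefl)) (nbhsx_ballx l r r0).
have sq (u v : R) : ball u r v -> (u - v) ^+ 2 <= r.
  rewrite /ball/= => /ltW uv.
  have r1 : r <= 1 by rewrite ge_min lexx.
  rewrite -(real_normK (num_real (u - v))).
  have := normr_ge0 (u - v); nra.
have s1 := sq _ _ b1; have s2 := sq _ _ b2.
have nx : zs - n%:R <= x.
  have : (N%:R : R) <= n%:R by rewrite ler_nat.
  lra.
apply: (@le_trans _ _ (2 * segint x 0 (density d0 del (comb (k n).1 (k n).2 P H)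
   (comb (k n).1 (k n).2 Q G)) +
   2 * ((l.1 - (k n).1) ^+ 2 + (l.2 - (k n).2) ^+ 2) * JJ)).
  rewrite -!segintZ; [|exact: iH|exact: iJ].
  rewrite -segintD; [|by apply: itgZ; exact: iJ|by apply: itgZ; exact: iH].
  apply: le_segint; [exact: iJ| |].
    by apply: itgD; apply: itgZ; [exact: iJ|exact: iH].
  by move=> t _; exact: density_comb_le.
apply: lerD; first by rewrite ler_pM2l//; exact: hk.
apply: (@le_trans _ _ (4 * r * JJ)); first by apply: ler_wpM2r => //; lra.
apply: (@le_trans _ _ (4 * (e / (4 * JJ + 1)) * JJ)).
  by apply: ler_wpM2r => //; rewrite ler_pM2l// ge_min lexx orbT.
rewrite mulrAC mulrA ler_pdivrMr; nra.
Qed.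

End two_branches.

(** * Profile equation and coefficients along the wave *)

Section wave_profile.
Context {R : realType}.
Implicit Types (x y z s t u w : R).
Variables (a b k : R).

(** The divided difference of Phi. *)
Definition chord u w : R := (u ^+ 2 + u * w + w ^+ 2) / 3 - (a + b) * (u + w) / 2 + a * b.

Lemma Phi_chord u w : Phi a b u - Phi a b w = (u - w) * chord u w.
Proof. by rewrite /Phi /chord; field. Qed.

Lemma chord_diag u : chord u u = Dif a b u.
Proof. by rewrite /chord /Dif; field. Qed.

(** The minimum of D on the range of each branch, attained at the shock values. *)
Definition gap : R := (b - a) ^+ 2 / 2.

Lemma sqr_sqrt3 : Num.sqrt 3 ^+ 2 = 3 :> R.
Proof. by rewrite sqr_sqrtr. Qed.

(** In the coordinate u - (a + b) / 2 and with h = (b - a) / 2, D is u^2 - h^2 and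
    the chord is (u^2 + u w + w^2) / 3 - h^2, where u and w are of the same
    sign with |u|, |w| >= sqrt 3 h. *)
Lemma chord_ge u w : a < b ->
  (u_r a b <= u /\ u_r a b <= w) \/ (u <= u_l a b /\ w <= u_l a b) ->
  gap <= chord u w.
Proof.
move=> ab; rewrite /u_r /u_l /gap /chord.
set q := Num.sqrt 3 => H; have q2 : q ^+ 2 = 3 := sqr_sqrt3.
have q0 : 0 <= q by exact: sqrtr_ge0.
pose h := (b - a) / 2; have h0 : 0 < h by rewrite /h; lra.
pose X := u - (a + b) / 2; pose Y := w - (a + b) / 2.
have key : 3 * h ^+ 2 <= X ^+ 2 /\ 3 * h ^+ 2 <= X * Y /\ 3 * h ^+ 2 <= Y ^+ 2.
  have qh : 0 <= q * h by rewrite mulr_ge0// ltW.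
  have -> : 3 * h ^+ 2 = (q * h) * (q * h) by rewrite -q2; ring.
  case: H => -[Hu Hw].
    have XX : q * h <= X by rewrite /X /h; lra.
    have YY : q * h <= Y by rewrite /Y /h; lra.
    by rewrite !expr2; split; [|split]; apply: ler_pM.
  have XX : q * h <= - X by rewrite /X /h; lra.
  have YY : q * h <= - Y by rewrite /Y /h; lra.
  rewrite -[X * Y]mulrNN -[X ^+ 2]sqrrN -[Y ^+ 2]sqrrN !expr2.
  by split; [|split]; apply: ler_pM.
rewrite -subr_ge0.
set r := (X in 0 <= X).
have -> : r = (X ^+ 2 + X * Y + Y ^+ 2) / 3 - 3 * h ^+ 2.
  by rewrite /r /X /Y /h; field.
lra.
Qed.

Lemma Dif_ge u : a < b -> u_r a b <= u \/ u <= u_l a b -> gap <= Dif a b u.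
Proof. by move=> ab H; rewrite -chord_diag; apply: chord_ge => //; tauto. Qed.

Lemma gap_gt0 : a < b -> 0 < gap.
Proof. by move=> ab; rewrite divr_gt0// exprn_even_gt0//=; apply/eqP; lra. Qed.

Lemma Dif_u_r : Dif a b (u_r a b) = gap.
Proof.
rewrite /Dif /u_r /gap; set q := Num.sqrt 3; have q2 : q ^+ 2 = 3 := sqr_sqrt3.
have -> : ((a + b + q * (b - a)) / 2 - a) * ((a + b + q * (b - a)) / 2 - b) =
  (q ^+ 2 - 1) * (b - a) ^+ 2 / 4 by field.
by rewrite q2; field.
Qed.

Lemma Dif_u_l : Dif a b (u_l a b) = gap.
Proof.
rewrite /Dif /u_l /gap; set q := Num.sqrt 3; have q2 : q ^+ 2 = 3 := sqr_sqrt3.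
have -> : ((a + b - q * (b - a)) / 2 - a) * ((a + b - q * (b - a)) / 2 - b) =
  (q ^+ 2 - 1) * (b - a) ^+ 2 / 4 by field.
by rewrite q2; field.
Qed.

Lemma Phi_u_r : Phi a b (u_r a b) = Phi a b (u_l a b).
Proof.
apply/eqP; rewrite -subr_eq0 Phi_chord; apply/eqP.
suff -> : chord (u_r a b) (u_l a b) = 0 by rewrite mulr0.
rewrite /chord /u_l /u_r; set q := Num.sqrt 3; have q2 : q ^+ 2 = 3 := sqr_sqrt3.
transitivity ((q ^+ 2 - 3) * (b - a) ^+ 2 / 12); first by field.
by rewrite q2 subrr !mul0r.
Qed.

(** Phi vanishes at 1 and increases on [u_r, 1]. *)
Lemma Phi_u_r_lt0 : a < b -> u_r a b < 1 -> Phi a b (u_r a b) < 0.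
Proof.
move=> ab ur1; have := Phi_chord (u_r a b) 1; rewrite Phi1 subr0 => ->.
have g0 := gap_gt0 ab.
have : gap <= chord (u_r a b) 1 by apply: chord_ge => //; left; split => //; exact: ltW.
nra.
Qed.

(** Phi is invertible on each branch with a Lipschitz inverse, which makes the wave
    continuous. *)
Lemma inverse_Phi_lip u w : a < b ->
  (u_r a b <= u /\ u_r a b <= w) \/ (u <= u_l a b /\ w <= u_l a b) ->
  `|u - w| <= `|Phi a b u - Phi a b w| / gap.
Proof.
move=> ab H; rewrite Phi_chord normrM ler_pdivlMr; last exact: gap_gt0.
apply: ler_wpM2l => //; apply: le_trans (ler_norm _); exact: chord_ge.
Qed.

(** The z-derivative of D along the wave, divided by k. *)
Definition slope u : R := (2 * u - a - b) * Phi a b u / Dif a b u.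

Definition slope' u : R :=
  (2 * Phi a b u + (2 * u - a - b) * Dif a b u) / Dif a b u -
  (2 * u - a - b) ^+ 2 * Phi a b u / Dif a b u ^+ 2.

Definition Rsrc' u : R :=
  - (k ^+ 2 * Dif a b 0) * (2 * u - a - b) * Phi a b u / Dif a b u ^+ 2 +
  (k ^+ 2 * Dif a b 0 / Dif a b u - k ^+ 2) * Dif a b u.

Lemma is_derive_Dif u : is_derive u 1 (Dif a b) (2 * u - a - b).
Proof.
rewrite /Dif; apply: is_derive_eq.
by rewrite /GRing.scale/=; ring.
Qed.

Lemma is_derive_Dif_inv u : Dif a b u != 0 ->
  is_derive u 1 (fun w => (Dif a b w)^-1) (- (2 * u - a - b) / Dif a b u ^+ 2).
Proof.
move=> Du; have h := is_derive_Dif u.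
apply: (is_derive_eq (is_deriveV Du h)).
by rewrite /GRing.scale/=; field.
Qed.

Lemma derive1_Dif : derive1 (Dif a b) = fun u => 2 * u - a - b.
Proof. by apply/funext => u; rewrite derive1E; have [_] := is_derive_Dif u. Qed.

Lemma is_derive_slope u : Dif a b u != 0 -> is_derive u 1 slope (slope' u).
Proof.
move=> Du; have h1 := is_derive_Dif_inv Du; have h2 := is_derive_Phi a b u.
apply: is_derive_eq.
rewrite /slope' /GRing.scale/=; field.
by [].
Qed.

Lemma DzzE u : Dif a b u != 0 ->
  Dzz a b k u = k ^+ 2 * (Phi a b u / Dif a b u) * slope' u.
Proof.
move=> Du; rewrite /Dzz derive1_Dif derive1E.
by have [_ ->] := is_derive_slope Du.
Qed.

Lemma derive1_Rsrc u : Dif a b u != 0 -> derive1 (Rsrc a b k) u = Rsrc' u.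
Proof.
move=> Du; have h1 := is_derive_Dif_inv Du; have h2 := is_derive_Phi a b u.
suff [_ h] : is_derive u 1 (Rsrc a b k) (Rsrc' u) by rewrite derive1E h.
rewrite /Rsrc; apply: is_derive_eq.
rewrite /Rsrc' /GRing.scale/=; field.
by [].
Qed.

Lemma continuous_Phi : continuous (Phi a b).
Proof.
move=> u; apply/differentiable_continuous/derivable1_diffP.
by have [] := is_derive_Phi a b u.
Qed.

Lemma continuous_Dif : continuous (Dif a b).
Proof.
move=> u; apply/differentiable_continuous/derivable1_diffP.
by have [] := is_derive_Dif u.
Qed.

Lemma continuous_affine : continuous (fun u => 2 * u - a - b).
Proof.
move=> u; apply: cvgB; last exact: cvg_cst.
by apply: cvgB; [apply: cvgM; [exact: cvg_cst|exact: cvg_id]|exact: cvg_cst].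
Qed.

Lemma continuous_Dif_inv u : Dif a b u != 0 -> {for u, continuous (fun w => (Dif a b w)^-1)}.
Proof. by move=> Du; apply: cvgV => //; exact: continuous_Dif. Qed.

Lemma continuous_slope u : Dif a b u != 0 -> {for u, continuous slope}.
Proof.
move=> Du; apply: cvgM; last exact: continuous_Dif_inv.
by apply: cvgM; [exact: continuous_affine|exact: continuous_Phi].
Qed.

Lemma continuous_slope' u : Dif a b u != 0 -> {for u, continuous slope'}.
Proof.
move=> Du; have cV := continuous_Dif_inv Du.
have sq w : Dif a b w ^- 2 = (Dif a b w)^-1 * (Dif a b w)^-1 by rewrite expr2 invfM.
rewrite /slope'; apply: cvgB.
  apply: cvgM => //; apply: cvgD; apply: cvgM; by
    [exact: cvg_cst|exact: continuous_Phi|exact: continuous_affine|exact: continuous_Dif].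
under eq_fun do rewrite sq; rewrite sq; apply: cvgM; last exact: cvgM.
apply: cvgM; last exact: continuous_Phi.
under eq_fun do rewrite expr2; rewrite expr2; apply: cvgM; exact: continuous_affine.
Qed.

Lemma continuous_Rsrc' u : Dif a b u != 0 -> {for u, continuous Rsrc'}.
Proof.
move=> Du; have cV := continuous_Dif_inv Du.
have sq w : Dif a b w ^- 2 = (Dif a b w)^-1 * (Dif a b w)^-1 by rewrite expr2 invfM.
rewrite /Rsrc'; apply: cvgD.
  under eq_fun do rewrite sq; rewrite sq; apply: cvgM; last exact: cvgM.
  apply: cvgM; last exact: continuous_Phi.
  by apply: cvgM; [exact: cvg_cst|exact: continuous_affine].
apply: cvgM; last exact: continuous_Dif.
by apply: cvgB; [apply: cvgM => //; exact: cvg_cst|exact: cvg_cst].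
Qed.

(** Closed form of Dzz, valid where D does not vanish. *)
Definition Dzz' u : R := k ^+ 2 * (Phi a b u / Dif a b u) * slope' u.

Lemma continuous_Dzz' u : Dif a b u != 0 -> {for u, continuous Dzz'}.
Proof.
move=> Du; apply: cvgM; last exact: continuous_slope'.
apply: cvgM; first exact: cvg_cst.
by apply: cvgM; [exact: continuous_Phi|exact: continuous_Dif_inv].
Qed.

(** On a compact range of values the stability condition holds with a margin. *)
Lemma uniform_bounds lo hi : lo <= hi ->
  (forall u, lo <= u <= hi -> 0 < Dif a b u) ->
  (forall u, lo <= u <= hi -> Dzz a b k u / 2 + derive1 (Rsrc a b k) u < 0) ->
  exists del K : R, [/\ 0 < del,
    forall u, lo <= u <= hi -> Dzz' u / 2 + Rsrc' u <= - del &
    forall u, lo <= u <= hi -> [/\ `|Dif a b u| <= K, `|k * slope u| <= K,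
      `|Dzz' u| <= K & `|Rsrc' u| <= K]].
Proof.
move=> lohi Dpos neg.
have D0 u : `[lo, hi]%classic u -> Dif a b u != 0.
  by rewrite /= in_itv/= => /Dpos; exact: lt0r_neq0.
have cont (g : R -> R) : (forall u, Dif a b u != 0 -> {for u, continuous g}) ->
    {within `[lo, hi], continuous g}.
  move=> cg; apply: continuous_in_subspaceT => u; rewrite inE => hu.
  exact: cg (D0 u hu).
have c1 := cont _ (fun u _ => @continuous_Dif u).
have c2 : {within `[lo, hi], continuous (fun u => k * slope u)}.
  apply: cont => u Du; apply: cvgM; [exact: cvg_cst|exact: continuous_slope].
have c3 := cont _ continuous_Dzz'.
have c4 := cont _ continuous_Rsrc'.
have c5 : {within `[lo, hi], continuous (fun u => Dzz' u / 2 + Rsrc' u)}.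
  apply: cont => u Du; apply: cvgD; last exact: continuous_Rsrc'.
  by apply: cvgM; [exact: continuous_Dzz'|exact: cvg_cst].
have [M1 h1] := within_continuous_bounded c1.
have [M2 h2] := within_continuous_bounded c2.
have [M3 h3] := within_continuous_bounded c3.
have [M4 h4] := within_continuous_bounded c4.
have [p plohi pmax] := EVT_max lohi c5.
exists (- (Dzz' p / 2 + Rsrc' p)), (Num.max (Num.max M1 M2) (Num.max M3 M4)).
have Dp := D0 p plohi.
split.
- rewrite oppr_gt0 -derive1_Rsrc// /Dzz' -DzzE//; apply: neg.
  by move: plohi; rewrite in_itv.
- by move=> u hu; rewrite opprK; apply: pmax; rewrite in_itv.
- by move=> u hu; rewrite !le_max h1// h2// h3// h4// !orbT.
Qed.

(** By the profile equation v' = k Phi(v) / D(v), the derivative of D(v) is again a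
    function of v, namely k slope(v); the chain rule applied twice gives the branch. *)
Lemma wave_branch x y v (J : R -> Prop) d0 del K : x <= y -> 0 < d0 ->
  continuous v ->
  (forall t, x < t < y -> is_derive t 1 v (k * Phi a b (v t) / Dif a b (v t))) ->
  (forall t, x <= t <= y -> J (v t)) ->
  (forall u, J u -> d0 <= Dif a b u) ->
  (forall u, J u -> Dzz' u / 2 + Rsrc' u <= - del) ->
  (forall u, J u -> [/\ `|Dif a b u| <= K, `|k * slope u| <= K,
      `|Dzz' u| <= K & `|Rsrc' u| <= K]) ->
  branch x y d0 del K (Dif a b \o v) (fun t => k * slope (v t))
    (Dzz' \o v) (Rsrc' \o v).
Proof.
move=> xy d00 cv dv Jv JD Jneg JK.
have D0 t : x <= t <= y -> Dif a b (v t) != 0.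
  by move=> /Jv/JD h; rewrite lt0r_neq0//; exact: lt_le_trans h.
have cont (g : R -> R) : (forall u, Dif a b u != 0 -> {for u, continuous g}) ->
    {within `[x, y], continuous (fun t => g (v t))}.
  move=> cg; apply: continuous_in_subspaceT => t; rewrite inE/= in_itv/= => ht.
  apply: (@continuous_comp _ _ _ v g); first exact: cv.
  exact: cg (D0 t ht).
have c1 := cont _ (fun u _ => @continuous_Dif u).
have c2 : {within `[x, y], continuous (fun t => k * slope (v t))}.
  apply: (cont (fun u => k * slope u)) => u Du; apply: cvgM; [exact: cvg_cst|exact: continuous_slope].
have c3 := cont _ continuous_Dzz'.
have c4 := cont _ continuous_Rsrc'.
split.
- apply: (primitive_C1 xy c1 c2) => t txy.
  have h1 := dv t txy; have h2 := is_derive_Dif (v t).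
  apply: (is_derive_eq (is_derive1_comp h2 h1)).
  by rewrite /slope /GRing.scale/=; ring.
- apply: (primitive_C1 xy c2 c3) => t txy.
  have Dt : Dif a b (v t) != 0 by apply: D0; lra.
  have h1 := dv t txy; have h2 := is_derive_slope Dt.
  have h3 := is_derive1_comp h2 h1.
  apply: is_derive_eq.
  by rewrite /Dzz' /GRing.scale/=; ring.
- exact: subspace_continuous_measurable_fun c4.
- by move=> t /Jv/JD.
- by move=> t /Jv/Jneg.
- by move=> t /Jv/JK.
Qed.

(** Phi has a nonvanishing divided difference along v, so v inherits the
   derivative of Phi o v. *)
Lemma is_derive_inverse_Phi v z g : Dif a b (v z) != 0 -> {for z, continuous v} ->
  (\forall w \near z, chord (v w) (v z) != 0) ->
  is_derive z 1 (fun w => Phi a b (v w)) g -> is_derive z 1 v (g / Dif a b (v z)).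
Proof.
move=> Dz cv chv [dg gE].
have cvg : h^-1 *: (v (h + z) - v z) @[h --> 0^'] --> g / Dif a b (v z).
  have c1 : h^-1 *: (Phi a b (v (h + z)) - Phi a b (v z)) @[h --> 0^'] --> g.
    have : cvg (h^-1 *: (Phi a b (v (h + z)) - Phi a b (v z)) @[h --> 0^']).
      move: dg; rewrite /derivable.
      by under eq_fun do rewrite /= [_ *: 1]mulr1.
    move=> /cvg_ex[l hl].
    suff -> : g = l by [].
    rewrite -gE /derive; apply: cvg_lim => //=.
    by under eq_fun do rewrite /= [_ *: 1]mulr1.
  have sh : h + z @[h --> (0 : R)^'] --> z.
    rewrite -[X in _ --> X]add0r; apply: cvgD; last exact: cvg_cst.
    exact: (cvg_within_filter _ cvg_id).
  have c2 : (chord (v (h + z)) (v z))^-1 @[h --> 0^'] --> (Dif a b (v z))^-1.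
    rewrite -chord_diag; apply: cvgV; first by rewrite chord_diag.
    have vsh : v (h + z) @[h --> (0 : R)^'] --> v z by exact: (cvg_comp _ _ sh cv).
    have cc : {for v z, continuous (fun u => chord u (v z))}.
      apply: cvgD; last exact: cvg_cst; apply: cvgB; apply: cvgM; try exact: cvg_cst.
        apply: cvgD; last exact: cvg_cst; apply: cvgD.
          by rewrite expr2; apply: cvgM; exact: cvg_id.
        by apply: cvgM; [exact: cvg_id|exact: cvg_cst].
      by apply: cvgM; [exact: cvg_cst|apply: cvgD; [exact: cvg_id|exact: cvg_cst]].
    exact: (cvg_comp _ _ vsh cc).
  have : h^-1 *: (Phi a b (v (h + z)) - Phi a b (v z)) *
     (chord (v (h + z)) (v z))^-1 @[h --> 0^'] --> g / Dif a b (v z) by exact: cvgM.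
  apply: cvg_trans; apply: near_eq_cvg.
  near=> h.
  have ch : chord (v (h + z)) (v z) != 0 by near: h; exact: (sh _ chv).
  by rewrite Phi_chord /GRing.scale/= mulrA mulfK.
have e : h^-1 *: ((v \o shift z) (h *: 1) - v z) @[h --> 0^'] --> g / Dif a b (v z).
  by under eq_fun do rewrite /= [_ *: 1]mulr1.
by split; [apply/cvg_ex; exists (g / Dif a b (v z))|apply: cvg_lim].
Unshelve. all: by end_near. Qed.

End wave_profile.

(** * The two sides of the shock *)

Section shock.
Context {R : realType}.
Implicit Types (x y z s t u w : R).
Variables (a b k zs : R) (ubar : R -> R).
Hypotheses (ab : a < b) (k0 : 0 < k) (wave : shock_wave a b k zs ubar).

(** Each branch of the wave is continued by a constant, so as to be continuous on
    the whole line and to take its one-sided limit at the shock. *)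
Definition left_profile t : R := if t < zs then ubar t else u_r a b.

Definition right_profile t : R :=
  if t <= zs then u_l a b else if t <= 0 then ubar t else ubar 0.

Lemma left_range t : u_r a b <= left_profile t <= 1.
Proof.
have [_ _ hl _] := wave; rewrite /left_profile; case: (ltP t zs) => tz.
  by have [/andP[h1 h2] _] := hl t tz; rewrite !ltW.
by rewrite lexx; have [h _] := hl (zs - 1) ltac:(lra); lra.
Qed.

Lemma right_range t : 0 <= right_profile t <= u_l a b.
Proof.
have [zs0 _ _ hr] := wave; rewrite /right_profile.
have h0 : 0 <= ubar 0 < u_l a b.
  have zt0 : zs < 0 <= (0 : R) by rewrite zs0 lexx.
  by have [] := hr 0 zt0.
case: (leP t zs) => tz; first by lra.
case: (leP t 0) => t0; last by lra.
have zt0 : zs < t <= 0 by rewrite tz.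
by have [] := hr t zt0; lra.
Qed.

Lemma Phi_left t :
  Phi a b (left_profile t) = Phi a b 0 * expR (k * Num.min t zs).
Proof.
have [_ hs hl _] := wave; rewrite /left_profile; case: (ltP t zs) => tz.
  by have [_ ->] := hl t tz.
by rewrite Phi_u_r.
Qed.

Lemma Phi_right t :
  Phi a b (right_profile t) = Phi a b 0 * expR (k * Num.max zs (Num.min t 0)).
Proof.
have [zs0 hs _ hr] := wave; rewrite /right_profile.
case: (leP t zs) => tz.
  rewrite hs; congr (_ * expR (_ * _)); apply/esym/max_l.
  by rewrite ge_min tz.
case: (leP t 0) => t0.
  have zt0 : zs < t <= 0 by rewrite tz.
  by have [_ ->] := hr t zt0; rewrite max_r// ltW.
have zt0 : zs < 0 <= (0 : R) by rewrite zs0 lexx.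
by have [_ ->] := hr 0 zt0; rewrite max_r// ltW.
Qed.

Lemma continuous_lip (v g : R -> R) (d0 : R) : 0 < d0 -> continuous g ->
  (forall z w, `|v z - v w| <= `|g z - g w| / d0) -> continuous v.
Proof.
move=> d00 cg h z; apply/cvgrPdist_le => e e0.
have ed : 0 < e * d0 by exact: mulr_gt0.
have := cg z; move/cvgrPdist_le/(_ _ ed); apply: filterS => w hw.
by apply: le_trans (h _ _) _; rewrite ler_pdivrMr.
Qed.

Lemma continuous_left : continuous left_profile.
Proof.
apply: (continuous_lip (gap_gt0 ab) (g := fun t => Phi a b (left_profile t))).
  under eq_fun do rewrite Phi_left; move=> t.
  apply: cvgM; first exact: cvg_cst.
  apply: (@continuous_comp _ _ _ (fun t => k * Num.min t zs) expR); last exact: continuous_expR.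
  apply: cvgM; first exact: cvg_cst.
  by apply: (continuous_min (f := fun t => t) (g := fun=> zs)); [exact: cvg_id|exact: cvg_cst].
move=> z w; apply: inverse_Phi_lip => //; left.
by have /andP[-> _] := left_range z; have /andP[-> _] := left_range w.
Qed.

Lemma continuous_right : continuous right_profile.
Proof.
apply: (continuous_lip (gap_gt0 ab) (g := fun t => Phi a b (right_profile t))).
  under eq_fun do rewrite Phi_right; move=> t.
  apply: cvgM; first exact: cvg_cst.
  apply: (@continuous_comp _ _ _ (fun t => k * Num.max zs (Num.min t 0)) expR); last exact: continuous_expR.
  apply: cvgM; first exact: cvg_cst.
  apply: (continuous_max (f := fun=> zs) (g := fun t => Num.min t 0)); first exact: cvg_cst.
  by apply: (continuous_min (f := fun t => t) (g := fun=> 0)); [exact: cvg_id|exact: cvg_cst].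
move=> z w; apply: inverse_Phi_lip => //; right.
by have /andP[_ ->] := right_range z; have /andP[_ ->] := right_range w.
Qed.

Lemma is_derive_exp_near (v : R -> R) t C :
  (\forall w \near t, Phi a b (v w) = C * expR (k * w)) ->
  is_derive t 1 (fun w => Phi a b (v w)) (k * Phi a b (v t)).
Proof.
move=> h; rewrite (nbhs_singleton h).
have h' : {near t, (fun w => C * expR (k * w)) =1 (fun w => Phi a b (v w))}.
  by apply: filterS h => w /esym.
apply: (near_eq_is_derive h').
apply: is_derive_eq.
by rewrite /GRing.scale/=; ring.
Qed.

Lemma is_derive_left t : t < zs ->
  is_derive t 1 left_profile (k * Phi a b (left_profile t) / Dif a b (left_profile t)).
Proof.
move=> tz; apply: is_derive_inverse_Phi.
- have := Dif_ge ab (or_introl (proj1 (andP (left_range t)))).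
  by have := gap_gt0 ab => h1 h2; rewrite lt0r_neq0//; exact: lt_le_trans h2.
- exact: continuous_left.
- near=> w; have h1 := gap_gt0 ab.
  rewrite lt0r_neq0//; apply: (lt_le_trans h1); apply: chord_ge => //; left.
  by have /andP[-> _] := left_range w; have /andP[-> _] := left_range t.
- apply: (@is_derive_exp_near _ _ (Phi a b 0)).
  near=> w; rewrite Phi_left min_l//; apply: ltW; near: w.
  exact: lt_nbhsl.
Unshelve. all: by end_near. Qed.

Lemma is_derive_right t : zs < t < 0 ->
  is_derive t 1 right_profile (k * Phi a b (right_profile t) / Dif a b (right_profile t)).
Proof.
move=> /andP[zt t0]; apply: is_derive_inverse_Phi.
- have := Dif_ge ab (or_intror (proj2 (andP (right_range t)))).
  by have := gap_gt0 ab => h1 h2; rewrite lt0r_neq0//; exact: lt_le_trans h2.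
- exact: continuous_right.
- near=> w; have h1 := gap_gt0 ab.
  rewrite lt0r_neq0//; apply: (lt_le_trans h1); apply: chord_ge => //; right.
  by have /andP[_ ->] := right_range w; have /andP[_ ->] := right_range t.
- apply: (@is_derive_exp_near _ _ (Phi a b 0)).
  near=> w; rewrite Phi_right.
  have w1 : zs < w by near: w; exact: lt_nbhsr.
  have w2 : w < 0 by near: w; exact: lt_nbhsl.
  by rewrite min_l ?max_r// ltW.
Unshelve. all: by end_near. Qed.

Lemma branch_weaken x y d0 del K del' K' D D1 D2 N :
  branch x y d0 del K D D1 D2 N -> del' <= del -> K <= K' ->
  branch x y d0 del' K' D D1 D2 N.
Proof.
move=> [h1 h2 h3 h4 h5 h6] dd KK; split => //.
  by move=> t ht; have := h5 t ht; lra.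
by move=> t ht; have [] := h6 t ht; split; apply: le_trans KK.
Qed.

Lemma shock_branches :
  (forall u : R, 0 <= u <= u_l a b \/ u_r a b <= u <= 1 ->
     Dzz a b k u / 2 + derive1 (Rsrc a b k) u < 0) ->
  exists del K : R, [/\ 0 < del,
    forall x, x <= zs -> branch x zs (gap a b) del K (Dif a b \o left_profile)
      (fun t => k * slope a b (left_profile t)) (Dzz' a b k \o left_profile)
      (Rsrc' a b k \o left_profile) &
    branch zs 0 (gap a b) del K (Dif a b \o right_profile)
      (fun t => k * slope a b (right_profile t)) (Dzz' a b k \o right_profile)
      (Rsrc' a b k \o right_profile)].
Proof.
have zs0 : zs < 0 by case: wave.
have g0 := gap_gt0 ab.
move=> neg.
have [|||dL [KL [dL0 nL bL]]] := @uniform_bounds R a b k (u_r a b) 1.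
- by have := left_range 0; lra.
- by move=> u /andP[ul _]; apply: lt_le_trans (Dif_ge ab (or_introl ul)).
- by move=> u hu; apply: neg; right.
have [|||dR [KR [dR0 nR bR]]] := @uniform_bounds R a b k 0 (u_l a b).
- by have := right_range 0; lra.
- by move=> u /andP[_ ul]; apply: lt_le_trans (Dif_ge ab (or_intror ul)).
- by move=> u hu; apply: neg; left.
exists (Num.min dL dR), (Num.max KL KR); split; first by rewrite lt_min dL0.
  move=> x xz.
  apply: branch_weaken (wave_branch (J := fun u => u_r a b <= u <= 1) xz g0
    continuous_left _ _ _ nL bL) _ _; rewrite ?ge_min ?le_max ?lexx ?orbT//.
  - by move=> t /andP[_]; exact: is_derive_left.
  - by move=> t _; exact: left_range.
  - by move=> u /andP[ul _]; exact: Dif_ge ab (or_introl ul).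
apply: branch_weaken (wave_branch (J := fun u => 0 <= u <= u_l a b) (ltW zs0) g0
    continuous_right _ _ _ nR bR) _ _; rewrite ?ge_min ?le_max ?lexx ?orbT//.
- by move=> t; exact: is_derive_right.
- by move=> t _; exact: right_range.
- by move=> u /andP[_ ul]; exact: Dif_ge ab (or_intror ul).
Qed.

Lemma left_at_shock : left_profile zs = u_r a b.
Proof. by rewrite /left_profile ltxx. Qed.

Lemma right_at_shock : right_profile zs = u_l a b.
Proof. by rewrite /right_profile lexx. Qed.

Lemma Dif_at_shock : Dif a b (left_profile zs) = Dif a b (right_profile zs).
Proof. by rewrite left_at_shock right_at_shock Dif_u_r Dif_u_l. Qed.

(** Phi and D take the same values at u_l and u_r, Phi being negative, whereas the
    derivative 2 u - a - b of D changes sign. *)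
Lemma slope_at_shock :
  k * slope a b (left_profile zs) <= k * slope a b (right_profile zs).
Proof.
have g0 := gap_gt0 ab.
rewrite left_at_shock right_at_shock ler_pM2l// /slope Dif_u_r Dif_u_l Phi_u_r.
rewrite ler_pM2r ?invr_gt0//.
have ur1 : u_r a b < 1.
  by have [_ _ hl _] := wave; have [h _] := hl (zs - 1) ltac:(lra); lra.
have := Phi_u_r_lt0 ab ur1; rewrite Phi_u_r => P0.
apply: ler_wnM2r; first exact: ltW.
rewrite /u_l /u_r; have : 0 <= Num.sqrt 3 * (b - a) :> R.
  by rewrite mulr_ge0 ?sqrtr_ge0// subr_ge0 ltW.
lra.
Qed.

End shock.

(** * Square integrability and differentiation on the half line *)

Section half_line.
Context {R : realType}.
Implicit Types (f g F G u v : R -> R) (x y z s t : R).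

Local Notation mu := (@lebesgue_measure R).

Lemma ae_neq c : {ae mu, forall t : R, t != c}.
Proof.
exists [set c]; split => //; first exact: lebesgue_measure_set1.
by move=> t /= /negP; rewrite negbK => /eqP.
Qed.

Lemma primitive_is_derive x y z F f : primitive x y F f ->
  x < z < y -> {for z, continuous f} -> is_derive z 1 F (f z).
Proof.
move=> [hf hF] /andP[xz zy] cf.
have [d1 d2] := continuous_FTC1_closed zy hf xz cf.
have near_eq : {near z, (fun t => segint x t f) \+ cst (F x) =1 F}.
  near=> t; have xt : x <= t by apply: ltW; near: t; exact: lt_nbhsr.
  have ty : t <= y by apply: ltW; near: t; exact: lt_nbhsl.
  by rewrite /= -(hF x t)// subrK.
apply: (near_eq_is_derive near_eq).
have h : is_derive z 1 (fun t => segint x t f) (f z).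
  by split; [exact: d1|rewrite -derive1E; exact: d2].
apply: is_derive_eq; by rewrite addr0.
Unshelve. all: by end_near. Qed.

(** Lebesgue's differentiation theorem. *)
Lemma primitive_ae_derive x y F f : primitive x y F f ->
  {ae mu, forall t, x < t < y -> is_derive t 1 F (f t)}.
Proof.
move=> [hf hF].
pose g := f \_ `[x, y].
have gi : mu.-integrable setT (EFin \o g).
  by have /integrable_mkcond := hf; rewrite restrict_EFin; apply.
have gl : locally_integrable setT g by exact: open_integrable_locally openT gi.
have gy w : mu.-integrable [set` Interval (BLeft x) (BRight w)] (EFin \o g).
  by apply: integrableS gi.
have /= H := FTC1 gy gl.
apply: aeS H => t H /andP[xt ty].
have [|d1 d2] := H; first by rewrite lte_fin.
have near_eq : {near t, (fun t => \int[mu]_(s in `[x, t]) g s) \+ cst (F x) =1 F}.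
  near=> s; have xs : x <= s by apply: ltW; near: s; exact: lt_nbhsr.
  have sy : s <= y by apply: ltW; near: s; exact: lt_nbhsl.
  rewrite /= -[RHS](subrK (F x)) hF//; congr (_ + _).
  apply: eq_Rintegral => w; rewrite inE/= in_itv/= => xws.
  by rewrite /g patchT// inE/= in_itv/=; lra.
apply: (near_eq_is_derive near_eq).
have h : is_derive t 1 (fun t => \int[mu]_(s in `[x, t]) g s) (f t).
  split; first exact: d1.
  by rewrite -derive1E d2 /g patchT// inE/= in_itv/=; lra.
apply: is_derive_eq; by rewrite addr0.
Unshelve. all: by end_near. Qed.

Lemma primitive_ae_derive_half F f : (forall x, x <= 0 -> primitive x 0 F f) ->
  {ae mu, forall t, t < 0 -> is_derive t 1 F (f t)}.
Proof.
move=> h.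
have n0 (n : nat) : - n%:R <= 0 :> R by rewrite oppr_le0.
have H : {ae mu, forall t, forall n : nat, - n%:R < t < 0 -> is_derive t 1 F (f t)}.
  by apply/ae_foralln => n; exact: primitive_ae_derive (h _ (n0 n)).
apply: aeS H => t H t0; apply: (H (Num.truncn `|t|).+1); rewrite t0 andbT.
rewrite ltrNl; apply: le_lt_trans (_ : `|t| < _); first by rewrite -normrN ler_norm.
by have /andP[_] := truncn_itv (normr_ge0 t).
Qed.

Lemma measurable_half_line g : (forall x, x <= 0 -> measurable_fun `[x, 0] g) ->
  measurable_fun `]-oo, (0 : R)] g.
Proof.
move=> h.
have -> : `]-oo, (0 : R)]%classic = \bigcup_(n : nat) `[- n%:R, 0]%classic.
  apply/seteqP; split => [t|t [n _]]; rewrite /= !in_itv/=; last by case/andP.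
  move=> t0; exists (Num.truncn `|t|).+1 => //=; rewrite in_itv/= t0 andbT lerNl.
  apply/ltW/le_lt_trans; first exact: (ler_norm (- t)).
  by rewrite normrN; have /andP[_] := truncn_itv (normr_ge0 t).
apply/measurable_fun_bigcup => // n.
by apply: h; rewrite oppr_le0.
Qed.

Lemma Lnorm2E g : (Lnorm mu 2%:E (EFin \o g) =
  (\int[mu]_x (g x ^+ 2)%:E) `^ 2^-1)%E.
Proof.
rewrite unlock; congr (_ `^ _)%E; apply: eq_integral => x _.
by rewrite /= powR_mulrn// real_normK ?num_real.
Qed.

Lemma Lfun2P g : g \in Lfun mu 2%:E <->
  measurable_fun setT g /\ (\int[mu]_x (g x ^+ 2)%:E < +oo)%E.
Proof.
split => [gL|[mg gi]].
  split; first by move/sub_Lfun_mfun : (gL); rewrite inE.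
  have /integrableP[_] := Lfun2_integrable_sqr gL.
  by under eq_integral do rewrite /= ger0_norm ?sqr_ge0//.
rewrite inE; apply/andP; split; rewrite inE//.
by rewrite /finite_norm/= Lnorm2E; exact: poweR_lty.
Qed.

Lemma segint_le_half_line g (B : R) : (forall t, t <= 0 -> 0 <= g t) ->
  (forall x, x <= 0 -> itg x 0 g) -> (forall x, x <= 0 -> segint x 0 g <= B) ->
  (\int[mu]_(t in `]-oo, 0%R]) (g t)%:E <= B%:E)%E.
Proof.
move=> g0 ig gB.
have mg : measurable_fun `]-oo, (0 : R)] (EFin \o g).
  apply/measurable_EFinP; apply: measurable_half_line => x x0.
  exact: itg_meas (ig x x0).
have U : `]-oo, (0 : R)]%classic = \bigcup_(n : nat) `[- n%:R, 0]%classic.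
  apply/seteqP; split => [t|t [n _]]; rewrite /= !in_itv/=; last by case/andP.
  move=> t0; exists (Num.truncn `|t|).+1 => //=; rewrite in_itv/= t0 andbT lerNl.
  apply/ltW/le_lt_trans; first exact: (ler_norm (- t)).
  by rewrite normrN; have /andP[_] := truncn_itv (normr_ge0 t).
rewrite U.
have n0 (n : nat) : - n%:R <= 0 :> R by rewrite oppr_le0.
have cvg : (\int[mu]_(t in `[(- n%:R)%R, 0%R]) (g t)%:E)%E @[n --> \oo] -->
    (\int[mu]_(t in \bigcup_(n : nat) `[(- n%:R)%R, 0%R]%classic) (g t)%:E)%E.
  apply: ge0_nondecreasing_set_cvg_integral => //.
  - move=> n m nm; apply/subsetPset; apply: subset_itv; rewrite bnd_simp//.
    by rewrite lerN2 ler_nat.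
  - by move=> n; apply: measurable_funS mg => //; apply: subset_itv; rewrite bnd_simp.
  - by move=> n t; rewrite /= in_itv/= => /andP[_ t0]; rewrite lee_fin g0.
apply: (cvge_to_le cvg).
near=> n; have := gB _ (n0 n); rewrite /segint /Rintegral -lee_fin fineK//.
exact: integrable_fin_num (ig _ (n0 n)).
Unshelve. all: by end_near. Qed.

(** Bounds uniform over the segments [x, 0] pass to the half line by monotone
    convergence. *)
Lemma Lfun2_patch g (B : R) (I : set R) : measurable I -> I `<=` `]-oo, 0] ->
  (forall x, x <= 0 -> measurable_fun `[x, 0] g) ->
  (forall x, x <= 0 -> itg x 0 (fun t => g t ^+ 2)) ->
  (forall x, x <= 0 -> segint x 0 (fun t => g t ^+ 2) <= B) ->
  g \_ I \in Lfun mu 2%:E.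
Proof.
move=> mI I0 mg ig gB.
have mg0 := measurable_half_line mg.
have mgI : measurable_fun I g by exact: measurable_funS mg0.
apply/Lfun2P; split; first by apply/(measurable_restrictT _ mI).
have -> : (\int[mu]_x ((g \_ I) x ^+ 2)%:E = \int[mu]_(x in I) (g x ^+ 2)%:E)%E.
  rewrite [RHS]integral_mkcond; apply: eq_integral => x _.
  by rewrite /patch; case: ifP => //; rewrite expr0n.
apply: (@le_lt_trans _ _ (\int[mu]_(x in `]-oo, 0%R]) (g x ^+ 2)%:E)%E).
  apply: ge0_subset_integral => //.
  - by apply/measurable_EFinP; exact: measurable_funX.
  - by move=> t _; rewrite lee_fin sqr_ge0.
apply: le_lt_trans (ltry B).
by apply: segint_le_half_line => // t _; exact: sqr_ge0.
Qed.

Lemma Lfun2_segment g x : g \in Lfun mu 2%:E ->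
  [/\ measurable_fun `[x, 0] g, itg x 0 (fun t => g t ^+ 2) &
      segint x 0 (fun t => g t ^+ 2) <= fine (\int[mu]_t (g t ^+ 2)%:E)].
Proof.
move=> gL; have [mg gi] := (Lfun2P g).1 gL.
have i2 := Lfun2_integrable_sqr gL.
have j2 : itg x 0 (fun t => g t ^+ 2) by exact: integrableS i2.
split => //; first exact: measurable_funTS.
rewrite /segint /Rintegral; apply: fine_le.
- exact: integrable_fin_num.
- exact: integrable_fin_num.
- apply: ge0_subset_integral => //.
  + by apply/measurable_EFinP; exact: measurable_funX.
  + by move=> t _; rewrite lee_fin sqr_ge0.
Qed.

Lemma cvg_left_cst l c g (L C : R) : l < c -> (forall z, l < z < c -> g z = C) ->
  g z @[z --> c^'-] --> L -> L = C.
Proof.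
move=> lc gC gL; apply/esym; apply: (@cvg_unique _ (@Rhausdorff R) (g z @[z --> c^'-])) => //.
apply: cvg_near_cst; near=> z; apply: gC; apply/andP; split; near: z.
  exact: nbhs_left_gt.
exact: nbhs_left_lt.
Unshelve. all: by end_near. Qed.

Lemma cvg_right_cst l c g (L C : R) : c < l -> (forall z, c < z < l -> g z = C) ->
  g z @[z --> c^'+] --> L -> L = C.
Proof.
move=> lc gC gL; apply/esym; apply: (@cvg_unique _ (@Rhausdorff R) (g z @[z --> c^'+])) => //.
apply: cvg_near_cst; near=> z; apply: gC; apply/andP; split; near: z.
  exact: nbhs_right_gt.
exact: nbhs_right_lt.
Unshelve. all: by end_near. Qed.

Lemma primitive_continuous_in x y z F f : primitive x y F f -> x < z < y ->
  {for z, continuous F}.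
Proof.
move=> hF xzy; have xy : x < y by lra.
have [+ _ _] := (continuous_within_itvP F xy).1 (primitive_continuous hF).
by apply; rewrite in_itv.
Qed.

Lemma primitive_cvg_left x y F f : x < y -> primitive x y F f ->
  F z @[z --> y^'-] --> F y.
Proof.
move=> xy hF.
by have [_ _] := (continuous_within_itvP F xy).1 (primitive_continuous hF).
Qed.

(** The two one-sided representations of u' by integrals fit together into a
   single one on the half line because u' is continuous at the interface. *)
Lemma H2_glue zs u rL rR : zs < 0 ->
  (forall z, z < 0 -> z != zs -> derivable u z 1) ->
  rL \_ `]-oo, zs[ \in Lfun mu 2%:E -> rR \_ `]zs, 0[ \in Lfun mu 2%:E ->
  (forall x y, x < zs -> y < zs -> x <= y ->
     derive1 u y - derive1 u x = \int[mu]_(t in `[x, y]) rL t) ->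
  (forall x y, zs < x < 0 -> zs < y < 0 -> x <= y ->
     derive1 u y - derive1 u x = \int[mu]_(t in `[x, y]) rR t) ->
  u z @[z --> 0^'-] --> (0 : R) ->
  {for zs, continuous u} -> {for zs, continuous (derive1 u)} ->
  exists U V r : R -> R, [/\ U 0 = 0, forall x, x <= 0 -> primitive x 0 U V,
    forall x, x <= 0 -> primitive x 0 V r,
    forall z, z < 0 -> U z = u z & forall z, z < 0 -> V z = derive1 u z].
Proof.
move=> zs0 du rL2 rR2 eL eR u0 cu cdu.
pose r := rL \_ `]-oo, zs[ \+ rR \_ `]zs, 0[.
have ir x : itg x 0 r.
  have [m1 i1 _] := Lfun2_segment x rL2; have [m2 i2 _] := Lfun2_segment x rR2.
  by apply: itgD; exact: itg_sqr.
pose m := zs / 2; have zm : zs < m < 0 by rewrite /m; lra.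
pose V z := (derive1 u m + segint m 0 r) - segint z 0 r.
have pV x : x <= 0 -> primitive x 0 V r by move=> x0; exact: primitive_segint_right.
have Vm : V m = derive1 u m by rewrite /V addrK.
have incR x y : zs < x -> x <= y -> y < 0 -> V y - V x = derive1 u y - derive1 u x.
  move=> zx xy y0; have x0 : x <= 0 by lra.
  rewrite (pV x x0).2 ?lexx// ?(ltW y0)// eR//; [|lra..].
  apply: eq_Rintegral => t; rewrite inE/= in_itv/= => ht.
  rewrite /r/= /patch !mem_setE !in_itv/= ifF ?add0r ?ifT//; lra.
have incL x y : y < zs -> x <= y -> V y - V x = derive1 u y - derive1 u x.
  move=> yz xy; have x0 : x <= 0 by lra.
  have y0 : y <= 0 by lra.
  rewrite (pV x x0).2 ?lexx// eL//; [|lra..].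
  apply: eq_Rintegral => t; rewrite inE/= in_itv/= => ht.
  rewrite /r/= /patch !mem_setE !in_itv/= ifT ?ifF ?addr0//; lra.
have cV z : z < 0 -> {for z, continuous V}.
  move=> z0; have z1 : z - 1 <= 0 by lra.
  apply: primitive_continuous_in (pV _ z1) _; lra.
have VR z : zs < z < 0 -> V z = derive1 u z.
  move=> /andP[zz z0]; have [zm'|mz] := leP z m.
    by have := incR z m zz zm' (proj2 (andP zm)); rewrite Vm; lra.
  by have := incR m z (proj1 (andP zm)) (ltW mz) z0; rewrite Vm; lra.
have Vzs : V zs = derive1 u zs.
  apply/eqP; rewrite -subr_eq0; apply/eqP.
  apply: (@cvg_right_cst 0 zs (fun z => V z - derive1 u z)) => //.
    by move=> z hz; rewrite VR// subrr.
  apply: cvgB; apply: cvg_at_right_filter; [exact: cV|exact: cdu].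
have VE z : z < 0 -> V z = derive1 u z.
  move=> z0; have [zz|zz|->//] := ltgtP z zs; last by apply: VR; rewrite zz.
  have : V zs - derive1 u zs = V z - derive1 u z.
    apply: (@cvg_left_cst z zs (fun z => V z - derive1 u z)) => //.
      by move=> w /andP[zw wz]; have := incL z w wz (ltW zw); lra.
    apply: cvgB; apply: cvg_at_left_filter; [exact: cV|exact: cdu].
  by rewrite Vzs subrr => /esym/eqP; rewrite subr_eq0 => /eqP.
have iV x : x <= 0 -> itg x 0 V.
  by move=> x0; apply: itg_continuous; exact: primitive_continuous (pV x x0).
pose U z := 0 - segint z 0 V.
have pU x : x <= 0 -> primitive x 0 U V.
  by move=> x0; apply: primitive_segint_right; exact: iV.
have inc x y : x <= y -> y < 0 -> (y < zs \/ zs < x) -> U y - U x = u y - u x.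
  move=> xy y0 hz; have x0 : x <= 0 by lra.
  rewrite (pU x x0).2 ?lexx ?(ltW y0)//; apply/esym.
  have du' t : x <= t <= y -> derivable u t 1.
    move=> ht; apply: du; first by lra.
    by apply/eqP => tz; move: ht; rewrite tz; case: hz; lra.
  suff pu : primitive x y u V by rewrite pu.2 ?lexx.
  have cux : {within `[x, y], continuous u}.
    by apply: derivable_within_continuous => t; rewrite in_itv/=; exact: du'.
  have cVx := primitive_continuous (primitiveS (pV x x0) (lexx x) (ltW y0)).
  apply: (primitive_C1 xy cux cVx) => t ht; split; first by apply: du'; lra.
    by rewrite -derive1E VE//; lra.
have cU z : z < 0 -> {for z, continuous U}.
  move=> z0; have z1 : z - 1 <= 0 by lra.
  apply: primitive_continuous_in (pU _ z1) _; lra.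
have U0 : U 0 = 0 by rewrite /U segint_pt subr0.
have UR z : zs < z < 0 -> U z = u z.
  move=> /andP[zz z0].
  have : U 0 - 0 = U z - u z.
    apply: (@cvg_left_cst z 0 (fun z => U z - u z)) => //.
      by move=> w /andP[zw w0]; have := inc z w (ltW zw) w0 (or_intror zz); lra.
    by apply: cvgB => //; apply: primitive_cvg_left zs0 (pU _ (ltW zs0)).
  by rewrite U0 subrr => /esym/eqP; rewrite subr_eq0 => /eqP.
have Uzs : U zs = u zs.
  apply/eqP; rewrite -subr_eq0; apply/eqP.
  apply: (@cvg_right_cst 0 zs (fun z => U z - u z)) => //.
    by move=> z hz; rewrite UR// subrr.
  apply: cvgB; apply: cvg_at_right_filter; [exact: cU|exact: cu].
exists U, V, r; split => // z z0.
have [zz|zz|->//] := ltgtP z zs; last by apply: UR; rewrite zz.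
have : U zs - u zs = U z - u z.
  apply: (@cvg_left_cst z zs (fun z => U z - u z)) => //.
    move=> w /andP[zw wz].
    by have := inc z w (ltW zw) (lt_trans wz zs0) (or_introl wz); lra.
  apply: cvgB; apply: cvg_at_left_filter; [exact: cU|exact: cu].
by rewrite Uzs subrr => /esym/eqP; rewrite subr_eq0 => /eqP.
Qed.

End half_line.

(** * The resolvent of the linearised operator *)

Section linearised_operator.
Context {R : realType}.
Implicit Types (x y z s t : R) (p : R -> R[i]) (b : bool).

Local Notation mu := (@lebesgue_measure R).

Variables (a1 b1 k zs : R) (ubar : R -> R).
Hypotheses (ab : a1 < b1) (k0 : 0 < k) (wave : shock_wave a1 b1 k zs ubar).

Local Notation vL := (left_profile a1 b1 zs ubar).
Local Notation vR := (right_profile a1 b1 zs ubar).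
Local Notation D := (Dif a1 b1).
Local Notation D1 := (fun u => k * slope a1 b1 u).
Local Notation D2 := (Dzz' a1 b1 k).
Local Notation N := (Rsrc' a1 b1 k).
Local Notation c := (speed a1 b1 k).

Definition comp b p : R -> R := if b then ReF p else ImF p.

Lemma join_profile (g : R -> R) t : t < 0 -> t != zs ->
  join zs (g \o vL) (g \o vR) t = g (ubar t).
Proof.
move=> t0 tz; rewrite /join /= /left_profile /right_profile.
by case: ltgtP tz => //= _ _; rewrite ltW.
Qed.

Lemma Dif_ubar_neq0 t : t < 0 -> t != zs -> D (ubar t) != 0.
Proof.
move=> t0 tz; have g0 := gap_gt0 ab.
rewrite -(join_profile D t0 tz) /join /= lt0r_neq0//; apply: (lt_le_trans g0).
case: ifP => _; apply: Dif_ge => //.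
  by left; have /andP[] := left_range wave t.
by right; have /andP[] := right_range wave t.
Qed.

Lemma is_derive_ubar t : t < 0 -> t != zs ->
  is_derive t 1 ubar (k * Phi a1 b1 (ubar t) / D (ubar t)).
Proof.
move=> t0; rewrite neq_lt => /orP[tz|zt].
  have h := is_derive_left ab wave tz.
  have e : {near t, vL =1 ubar}.
    near=> s; rewrite /left_profile ifT//; near: s; exact: lt_nbhsl.
  by have := near_eq_is_derive e h; rewrite /left_profile tz.
have h := @is_derive_right R a1 b1 k zs ubar ab wave t; rewrite zt t0 in h.
have {}h := h isT.
have e : {near t, vR =1 ubar}.
  near=> s; rewrite /right_profile leNgt ifF ?ifT//.
    by apply: ltW; near: s; exact: lt_nbhsl.
  by apply/negbTE; rewrite negbK; near: s; exact: lt_nbhsr.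
by have := near_eq_is_derive e h; rewrite /right_profile leNgt zt/= ltW.
Unshelve. all: by end_near. Qed.

Lemma is_derive_Dif_ubar t : t < 0 -> t != zs ->
  is_derive t 1 (D \o ubar) (D1 (ubar t)).
Proof.
move=> t0 tz; have h1 := is_derive_ubar t0 tz; have h2 := is_derive_Dif a1 b1 (ubar t).
apply: (is_derive_eq (is_derive1_comp h2 h1)).
by rewrite /slope /GRing.scale/=; ring.
Qed.

Lemma is_derive_slope_ubar t : t < 0 -> t != zs ->
  is_derive t 1 (fun s => D1 (ubar s)) (D2 (ubar t)).
Proof.
move=> t0 tz; have h1 := is_derive_ubar t0 tz.
have h2 := is_derive_slope (Dif_ubar_neq0 t0 tz).
have h3 := is_derive1_comp h2 h1.
apply: is_derive_eq.
by rewrite /Dzz' /GRing.scale/=; ring.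
Qed.

Lemma near_neq z w : z != w -> \forall y \near z, y != w.
Proof.
rewrite neq_lt => /orP[zw|wz]; near=> y; rewrite neq_lt; apply/orP.
  by left; near: y; exact: lt_nbhsl.
by right; near: y; exact: lt_nbhsr.
Unshelve. all: by end_near. Qed.

(** The product rule, applied twice: v is the derivative of u on both sides of the
    shock, but u'' is only required to exist at z. *)
Lemma second_derivative_product (u v : R -> R) (r : R) z : z < 0 -> z != zs ->
  (forall y, y < 0 -> y != zs -> is_derive y 1 u (v y)) -> is_derive z 1 v r ->
  derive1 (derive1 (fun y => D (ubar y) * u y)) z =
  D (ubar z) * r + 2 * D1 (ubar z) * v z + D2 (ubar z) * u z.
Proof.
move=> z0 zz du dv.
have e : {near z, (fun y => D (ubar y) * v y + D1 (ubar y) * u y) =1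
     derive1 (fun y => D (ubar y) * u y)}.
  near=> y.
  have y0 : y < 0 by near: y; exact: lt_nbhsl.
  have yz : y != zs by near: y; exact: near_neq.
  have h1 := is_derive_Dif_ubar y0 yz; have h2 := du y y0 yz.
  have [_ h] : is_derive y 1 (fun y => D (ubar y) * u y)
      (D (ubar y) * v y + D1 (ubar y) * u y).
    apply: is_derive_eq (is_deriveM h1 h2) _.
    by rewrite /GRing.scale/=; ring.
  by rewrite derive1E h.
have h1 := is_derive_Dif_ubar z0 zz; have h2 := du z z0 zz.
have h3 := is_derive_slope_ubar z0 zz.
have h4 : is_derive z 1 (fun y => D (ubar y) * v y + D1 (ubar y) * u y)
   (D (ubar z) * r + 2 * D1 (ubar z) * v z + D2 (ubar z) * u z).
  apply: is_derive_eq (is_deriveD (is_deriveM h1 dv) (is_deriveM h3 h2)) _.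
  by rewrite /GRing.scale/=; ring.
by have [_] := near_eq_is_derive e h4; rewrite derive1E.
Unshelve. all: by end_near. Qed.

Lemma Re_scale (x : R) (w : R[i]) : complex.Re (x%:C * w) = x * complex.Re w.
Proof. by case: w => w1 w2 /=; rewrite mul0r subr0. Qed.

Lemma Im_scale (x : R) (w : R[i]) : complex.Im (x%:C * w) = x * complex.Im w.
Proof. by case: w => w1 w2 /=; rewrite mul0r addr0. Qed.

Lemma ReD (v w : R[i]) : complex.Re (v + w) = complex.Re v + complex.Re w.
Proof. by case: v; case: w. Qed.

Lemma ImD (v w : R[i]) : complex.Im (v + w) = complex.Im v + complex.Im w.
Proof. by case: v; case: w. Qed.

Lemma ReN (w : R[i]) : complex.Re (- w) = - complex.Re w.
Proof. by case: w. Qed.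

Lemma ImN (w : R[i]) : complex.Im (- w) = - complex.Im w.
Proof. by case: w. Qed.

Lemma ReM (v w : R[i]) : complex.Re (v * w) =
  complex.Re v * complex.Re w - complex.Im v * complex.Im w.
Proof. by case: v; case: w. Qed.

Lemma ImM (v w : R[i]) : complex.Im (v * w) =
  complex.Re v * complex.Im w + complex.Im v * complex.Re w.
Proof. by case: v; case: w. Qed.

Variable lambda : R[i].
Local Notation m := (complex.Re lambda).
Local Notation nu := (complex.Im lambda).

(** The components of L p - lambda p at a point where p' is differentiable, which
    is almost every point. *)
Lemma comp_lin_op p (Q : bool -> R -> R) (r : bool -> R) z : z < 0 -> z != zs ->
  (forall b y, y < 0 -> y != zs -> is_derive y 1 (comp b p) (Q b y)) ->
  (forall b, is_derive z 1 (Q b) (r b)) ->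
  forall b, comp b (fun z => lin_op a1 b1 k ubar p z - lambda * p z) z =
    D (ubar z) * r b + (2 * D1 (ubar z) + c) * Q b z +
    (D2 (ubar z) + N (ubar z) - m) * comp b p z + sg b * nu * comp (~~ b) p z.
Proof.
move=> z0 zz dp dQ b.
have P2 b' := second_derivative_product z0 zz (dp b') (dQ b').
have dR := derive1_Rsrc k (Dif_ubar_neq0 z0 zz).
have ReE : ReF (fun y => (D (ubar y))%:C * p y) = fun y => D (ubar y) * ReF p y.
  by apply/funext => y; rewrite /ReF Re_scale.
have ImE : ImF (fun y => (D (ubar y))%:C * p y) = fun y => D (ubar y) * ImF p y.
  by apply/funext => y; rewrite /ImF Im_scale.
have d1 b' : derive1 (comp b' p) z = Q b' z.
  by have [_] := dp b' z z0 zz; rewrite derive1E.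
have := P2 true; have := P2 false; have := d1 true; have := d1 false.
rewrite /comp /sg => e1 e2 e3 e4.
case: b => /=.
  rewrite /ReF /lin_op dR ReD ReN ReM !ReD !Re_scale.
  have -> : complex.Re (deriv_c (deriv_c (fun y => (D (ubar y))%:C * p y)) z) =
     derive1 (derive1 (fun y => D (ubar y) * ReF p y)) z.
    by rewrite -ReE.
  have -> : complex.Re (deriv_c p z) = derive1 (ReF p) z by [].
  by rewrite e2 e4 /ReF; ring.
rewrite /ImF /lin_op dR ImD ImN ImM !ImD !Im_scale.
have -> : complex.Im (deriv_c (deriv_c (fun y => (D (ubar y))%:C * p y)) z) =
     derive1 (derive1 (fun y => D (ubar y) * ImF p y)) z.
  by rewrite -ImE.
have -> : complex.Im (deriv_c p z) = derive1 (ImF p) z by [].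
by rewrite e1 e3 /ImF /ReF; ring.
Qed.

Local Notation Iz := (`]-oo, (0 : R)[%classic).
Local Notation domain := (lin_dom zs : set (R -> R[i])).
Local Notation Dj := (join zs (D \o vL) (D \o vR)).
Local Notation D1j := (join zs (D1 \o vL) (D1 \o vR)).
Local Notation D2j := (join zs (D2 \o vL) (D2 \o vR)).
Local Notation Nj := (join zs (N \o vL) (N \o vR)).
Local Notation solvesJ x f P Q := (solves c m nu x 0 Dj D1j D2j Nj f P Q).

Let zs0 : zs < 0. Proof. by case: wave. Qed.

(** An element of the domain is determined by absolutely continuous functions on
    the closed half line: its C^1 matching at zs glues the two H^2 pieces, and its
    trace at 0 fixes the constant of integration. *)
Lemma lin_dom_representation p : domain p ->
  exists (P Q r : bool -> R -> R) (B : R),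
  [/\ forall b, P b 0 = 0 /\ forall x, x <= 0 ->
        primitive x 0 (P b) (Q b) /\ primitive x 0 (Q b) (r b),
      forall b z, z < 0 -> comp b p z = P b z,
      forall b z, z < 0 -> z != zs -> is_derive z 1 (comp b p) (Q b z) &
      forall x, x <= 0 -> segint x 0 (fun t => mass P t + mass Q t) <= B].
Proof.
move=> [p2 [dL pL qL [wL wL2 eL]] [dR pR qR [wR wR2 eR]] [tr ti] [cp cq]].
have der b z : z < 0 -> z != zs -> derivable (comp b p) z 1.
  move=> z0; rewrite neq_lt => /orP[zz|zz].
    have Iz' : `]-oo, zs[%classic z by rewrite /= in_itv.
    by have [hr hi] := dL z Iz'; case: b; [exact: hr|exact: hi].
  have Iz' : `]zs, 0[%classic z by rewrite /= in_itv/= zz.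
  by have [hr hi] := dR z Iz'; case: b; [exact: hr|exact: hi].
have one b : exists U V r : R -> R, [/\ U 0 = 0, forall x, x <= 0 -> primitive x 0 U V,
    forall x, x <= 0 -> primitive x 0 V r,
    forall z, z < 0 -> U z = comp b p z & forall z, z < 0 -> V z = derive1 (comp b p) z].
  apply: (H2_glue zs0 (der b) (rL := comp b wL) (rR := comp b wR)).
  - by case: wL2 => hr hi; case: b; [exact: hr|exact: hi].
  - by case: wR2 => hr hi; case: b; [exact: hr|exact: hi].
  - move=> x y xz yz xy; have := eL x y; rewrite /= !in_itv/= => /(_ xz yz xy) e.
    case: b.
      by have := congr1 (@complex.Re R) e; rewrite ReD ReN.
    by have := congr1 (@complex.Im R) e; rewrite ImD ImN.
  - move=> x y xz yz xy; have := eR x y; rewrite /= !in_itv/= => /(_ xz yz xy) e.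
    case: b.
      by have := congr1 (@complex.Re R) e; rewrite ReD ReN.
    by have := congr1 (@complex.Im R) e; rewrite ImD ImN.
  - by case: b; [exact: tr|exact: ti].
  - by case: cp => hr hi; case: b; [exact: hr|exact: hi].
  - by case: cq => hr hi; case: b; [exact: hr|exact: hi].
have bd b U V r : (forall x, x <= 0 -> primitive x 0 U V) ->
    (forall x, x <= 0 -> primitive x 0 V r) -> U 0 = 0 ->
    (forall z, z < 0 -> U z = comp b p z) ->
    (forall z, z < 0 -> V z = derive1 (comp b p) z) ->
    exists B : R, forall x, x <= 0 ->
      segint x 0 (fun t => U t ^+ 2) <= B /\ segint x 0 (fun t => V t ^+ 2) <= B.
  move=> pU pV U0 UE VE.
  have g0 : comp b p \_ Iz \in Lfun mu 2%:E by rewrite /comp; case: (b); case: p2.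
  have g1 : derive1 (comp b p) \_ `]-oo, zs[ \in Lfun mu 2%:E by rewrite /comp; case: (b); case: qL.
  have g2 : derive1 (comp b p) \_ `]zs, 0[ \in Lfun mu 2%:E by rewrite /comp; case: (b); case: qR.
  set n0 := fine (\int[mu]_t (((comp b p \_ Iz) t) ^+ 2)%:E).
  set n1 := fine (\int[mu]_t (((derive1 (comp b p) \_ `]-oo, zs[) t) ^+ 2)%:E).
  set n2 := fine (\int[mu]_t (((derive1 (comp b p) \_ `]zs, 0[) t) ^+ 2)%:E).
  have [n00 n10 n20] : [/\ 0 <= n0, 0 <= n1 & 0 <= n2].
    by split; apply/fine_ge0/integral_ge0 => t _; rewrite lee_fin sqr_ge0.
  exists (n0 + n1 + n2) => x x0.
  have [_ _ h0] := Lfun2_segment x g0.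
  have [m1 i1 h1] := Lfun2_segment x g1; have [m2 i2 h2] := Lfun2_segment x g2.
  rewrite -/n0 in h0; rewrite -/n1 in h1; rewrite -/n2 in h2.
  split.
    rewrite (@eq_segint _ _ _ _ (fun t => (comp b p \_ Iz) t ^+ 2)); first by lra.
    move=> t /andP[_]; rewrite le_eqVlt => /orP[/eqP ->|t0].
      by rewrite U0 patchE ifF// mem_setE in_itv/= ltxx.
    by rewrite UE// patchE ifT// mem_setE in_itv.
  have [|||_ <-] := @ae_itg_segint _ x 0
     (fun t => (derive1 (comp b p) \_ `]-oo, zs[) t ^+ 2 +
               (derive1 (comp b p) \_ `]zs, 0[) t ^+ 2) (fun t => V t ^+ 2).
  - exact: itgD.
  - by apply: measurable_funX; exact: primitive_meas (pV x x0).
  - apply: aeS (aeI (ae_neq zs) (ae_neq 0)) => t [tz t0] /andP[_].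
    rewrite le_eqVlt (negbTE t0)/= => {}t0; rewrite VE//.
    rewrite !patchE !mem_setE !in_itv/= t0 andbT.
    by case: ltgtP tz => //= _ _; rewrite expr0n/= ?addr0 ?add0r.
  - by rewrite segintD//; lra.
have [U1 [V1 [r1 [a0 a1' a2 a3 a4]]]] := one true.
have [U2 [V2 [r2 [c0 c1 c2 c3 c4]]]] := one false.
have [B1 hB1] := bd true U1 V1 r1 a1' a2 a0 a3 a4.
have [B2 hB2] := bd false U2 V2 r2 c1 c2 c0 c3 c4.
exists (fun b => if b then U1 else U2), (fun b => if b then V1 else V2),
  (fun b => if b then r1 else r2), (2 * B1 + 2 * B2); split.
- by case; split => // x x0; split; [exact: a1'|exact: a2|exact: c1|exact: c2].
- by case=> z z0; rewrite ?a3 ?c3.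
- move=> b z z0 zz; split; first exact: der.
  by rewrite -derive1E; case: b; rewrite ?a4 ?c4.
- move=> x x0; rewrite /mass.
  have [u1 v1] := hB1 x x0; have [u2 v2] := hB2 x x0.
  have sq u w : primitive x 0 u w -> itg x 0 (fun t => u t ^+ 2).
    move=> hu; apply: (primitive_itgM hu); apply: itg_continuous.
    exact: primitive_continuous hu.
  have s1 := sq _ _ (a1' x x0); have s2 := sq _ _ (a2 x x0).
  have s3 := sq _ _ (c1 x x0); have s4 := sq _ _ (c2 x x0).
  rewrite segintD; [|exact: itgD..].
  by rewrite !segintD//; lra.
Qed.

Hypothesis m0 : 0 <= m.
Hypothesis neg : forall u : R, 0 <= u <= u_l a1 b1 \/ u_r a1 b1 <= u <= 1 ->
  Dzz a1 b1 k u / 2 + derive1 (Rsrc a1 b1 k) u < 0.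

Local Notation resolvent_eq p f :=
  (ae_eq_on Iz (fun z => lin_op a1 b1 k ubar p z - lambda * p z) f).

(** The difference of two solutions is square integrable together with its
    derivative, and solves the homogeneous equation. *)
Lemma resolvent_unique p p' f : domain p -> domain p' ->
  resolvent_eq p f -> resolvent_eq p' f -> forall z, z < 0 -> p z = p' z.
Proof.
move=> dp dp' ep ep'.
have [del [K [del0 brL brR]]] := shock_branches ab wave neg.
have g0 := gap_gt0 ab.
have [P [Q [r [B [hP PE dP bP]]]]] := lin_dom_representation dp.
have [P' [Q' [r' [B' [hP' PE' dP' bP']]]]] := lin_dom_representation dp'.
pose dd b t := P b t - P' b t; pose ee b t := Q b t - Q' b t.
have pd b x : x <= 0 -> primitive x 0 (dd b) (ee b).
  by move=> x0; apply: primitiveB; [exact: ((hP b).2 x x0).1|exact: ((hP' b).2 x x0).1].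
have pe b x : x <= 0 -> primitive x 0 (ee b) (fun t => r b t - r' b t).
  by move=> x0; apply: primitiveB; [exact: ((hP b).2 x x0).2|exact: ((hP' b).2 x x0).2].
have aeQ : {ae mu, forall t, forall b, t < 0 -> is_derive t 1 (Q b) (r b t)}.
  have h b := @primitive_ae_derive_half R (Q b) (r b) (fun x hx => ((hP b).2 x hx).2).
  by apply: aeS (aeI (h true) (h false)) => t [h1 h2] [].
have aeQ' : {ae mu, forall t, forall b, t < 0 -> is_derive t 1 (Q' b) (r' b t)}.
  have h b := @primitive_ae_derive_half R (Q' b) (r' b) (fun x hx => ((hP' b).2 x hx).2).
  by apply: aeS (aeI (h true) (h false)) => t [h1 h2] [].
have sol x : x <= 0 -> solvesJ x (fun _ _ => 0) dd ee.
  move=> x0 b; split; first exact: pd.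
  have mb u w : primitive x 0 u w -> measurable_fun `[x, 0] u /\
      exists M : R, forall t, x <= t <= 0 -> `|u t| <= M.
    move=> hu; split; first exact: primitive_meas hu.
    exact: within_continuous_bounded (primitive_continuous hu).
  apply: primitive_ae (pe b x x0) _ _.
    apply: itg_meas; apply: (itg_second_join c m nu zs0 g0 brL brR) => //.
    - exact: itg_cst.
    - by move=> b'; exact: mb (pd b' x x0).
    - exact: mb (pe b x x0).
  apply: aeS (aeI (aeI aeQ aeQ') (aeI (aeI ep ep') (aeI (ae_neq zs) (ae_neq 0)))).
  move=> t [[q1 q2] [[e1 e2] [tz t0]]] /andP[_].
  rewrite le_eqVlt (negbTE t0)/= => {}t0.
  have E1 := comp_lin_op t0 tz dP (fun b => q1 b t0) b.
  have E2 := comp_lin_op t0 tz dP' (fun b => q2 b t0) b.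
  have It : Iz t by rewrite /= in_itv.
  have F12 : comp b (fun z => lin_op a1 b1 k ubar p z - lambda * p z) t =
             comp b (fun z => lin_op a1 b1 k ubar p' z - lambda * p' z) t.
    rewrite /comp /ReF /ImF.
    by case: (b); congr (_ _); rewrite e1// e2.
  rewrite F12 E2 !PE// !PE'// in E1.
  rewrite /second (join_profile D)// (join_profile D1)// (join_profile D2)// (join_profile N)//.
  have Dt := Dif_ubar_neq0 t0 tz.
  apply: (mulfI Dt); rewrite [RHS]mulrCA mulrV ?unitfE// mulr1 /dd /ee.
  lra.
have z1 := bounded_homogeneous_eq0 zs0 g0 del0 m0 brL brR
  (Dif_at_shock a1 b1 zs ubar) (slope_at_shock ab k0 wave) sol.
have {}z1 := z1 (2 * B + 2 * B').
move=> z z_lt0.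
have dz b : dd b z = 0.
  apply: z1; last exact: ltW.
    by move=> b'; rewrite /dd (hP b').1 (hP' b').1 subrr.
  move=> x x0.
  have im (u w g : bool -> R -> R) : (forall b, primitive x 0 (u b) (w b)) ->
      (forall b, primitive x 0 (w b) (g b)) -> itg x 0 (fun t => mass u t + mass w t).
    by move=> hu hw; apply: itgD; apply: itg_continuous;
      [exact: continuous_mass hu|exact: continuous_mass hw].
  have i1 := im _ _ _ (fun b => pd b x x0) (fun b => pe b x x0).
  have i2 := im _ _ _ (fun b => ((hP b).2 x x0).1) (fun b => ((hP b).2 x x0).2).
  have i3 := im _ _ _ (fun b => ((hP' b).2 x x0).1) (fun b => ((hP' b).2 x x0).2).
  apply: (@le_trans _ _ (2 * segint x 0 (fun t => mass P t + mass Q t) +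
     2 * segint x 0 (fun t => mass P' t + mass Q' t))).
    rewrite -!segintZ// -segintD; [|exact: itgZ..].
    apply: le_segint => //; first by apply: itgD; exact: itgZ.
    move=> t _; rewrite /mass /dd /ee.
    have sq2 (v w : R) : (v - w) ^+ 2 <= 2 * v ^+ 2 + 2 * w ^+ 2.
      by have := sqr_ge0 (v + w); nra.
    have := sq2 (P true t) (P' true t); have := sq2 (P false t) (P' false t).
    have := sq2 (Q true t) (Q' true t); have := sq2 (Q false t) (Q' false t).
    lra.
  by have := bP x x0; have := bP' x x0; lra.
have cz b : comp b p z = comp b p' z.
  by rewrite PE// PE'//; apply/eqP; rewrite -subr_eq0; apply/eqP; exact: dz.
have := cz true; have := cz false; rewrite /comp /ReF /ImF.
by case: (p z) => u1 u2; case: (p' z) => u3 u4 /= -> ->.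
Qed.

Lemma normc_sqr (w : R[i]) : ComplexField.Normc.normc w ^+ 2 =
  complex.Re w ^+ 2 + complex.Im w ^+ 2.
Proof. by case: w => u v /=; rewrite sqr_sqrtr// addr_ge0 ?sqr_ge0. Qed.

Lemma L2norm_mass p : L2norm Iz p =
  ((\int[mu]_(t in Iz) (mass (fun b => comp b p) t)%:E) `^ 2^-1)%E.
Proof.
rewrite /L2norm Lnorm2E; congr (_ `^ _)%E.
rewrite [RHS]integral_mkcond; apply: eq_integral => t _.
by rewrite /patch; case: ifP => _; rewrite ?normc_sqr// expr0n.
Qed.

(** The solution found by shooting has p and p' in L^2, by the energy bound, and p''
    in L^2, by the equation; the energy bound also controls its norm. *)
Lemma resolvent_exists : exists C : R, forall f, L2 Iz f ->
  exists p, [/\ domain p, resolvent_eq p f & (L2norm Iz p <= C%:E * L2norm Iz f)%E].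
Proof.
have [del [K [del0 brL brR]]] := shock_branches ab wave neg.
have g0 := gap_gt0 ab.
exists (2 / del) => f f2.
pose ff b := comp b f \_ Iz.
have ffL b : ff b \in Lfun mu 2%:E by rewrite /ff /comp; case: b; case: f2.
pose M := fine (\int[mu]_t (ff true t ^+ 2)%:E) + fine (\int[mu]_t (ff false t ^+ 2)%:E).
have df : datum ff M.
  split=> [b x x0|x x0]; first by have [] := Lfun2_segment x (ffL b).
  have [_ i1 h1] := Lfun2_segment x (ffL true).
  have [_ i2 h2] := Lfun2_segment x (ffL false).
  by rewrite /mass segintD// lerD.
have M0 : 0 <= M by rewrite addr_ge0// fine_ge0// integral_ge0// => t _; rewrite lee_fin sqr_ge0.
have [P [Q [P0 sol bd]]] := existence c nu zs0 g0 del0 m0 brL brR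
  (Dif_at_shock a1 b1 zs ubar) (slope_at_shock ab k0 wave) df.
pose r b := second c m nu Dj D1j D2j Nj ff P Q b.
have pP b x : x <= 0 -> primitive x 0 (P b) (Q b) by move=> x0; exact: (sol x x0 b).1.
have pQ b x : x <= 0 -> primitive x 0 (Q b) (r b) by move=> x0; exact: (sol x x0 b).2.
have n1 z : z < 0 -> z - 1 <= 0 by lra.
have n2 z : z < 0 -> z - 1 < z < 0 by lra.
have cP b z : z < 0 -> {for z, continuous (P b)}.
  by move=> z0; exact: primitive_continuous_in (pP b _ (n1 z z0)) (n2 z z0).
have cQ b z : z < 0 -> {for z, continuous (Q b)}.
  by move=> z0; exact: primitive_continuous_in (pQ b _ (n1 z z0)) (n2 z z0).
have dP b z : z < 0 -> is_derive z 1 (P b) (Q b z).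
  by move=> z0; exact: primitive_is_derive (pP b _ (n1 z z0)) (n2 z z0) (cQ b z z0).
have dP1 b z : z < 0 -> derive1 (P b) z = Q b z.
  by move=> z0; rewrite derive1E; have [] := dP b z z0.
have sq x u w : primitive x 0 u w -> itg x 0 (fun t => u t ^+ 2).
  move=> hu; apply: (primitive_itgM hu); apply: itg_continuous.
  exact: primitive_continuous hu.
have iP b x : x <= 0 -> itg x 0 (fun t => P b t ^+ 2).
  by move=> x0; exact: sq (pP b x x0).
have iQ b x : x <= 0 -> itg x 0 (fun t => Q b t ^+ 2).
  by move=> x0; exact: sq (pQ b x x0).
have imP x : x <= 0 -> itg x 0 (mass P) by move=> x0; apply: itgD; exact: iP.
have imQ x : x <= 0 -> itg x 0 (mass Q) by move=> x0; apply: itgD; exact: iQ.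
have imf x : x <= 0 -> itg x 0 (mass ff).
  by move=> x0; apply: itgD; exact: (df.1 _ x x0).2.
have dens x : x <= 0 -> gap a1 b1 * segint x 0 (mass Q) + del / 2 * segint x 0 (mass P) <= M / del.
  move=> x0; apply: le_trans (bd x x0).
  rewrite -(segintZ _ (imQ x x0)) -(segintZ _ (imP x x0)).
  by rewrite -segintD; [|apply: itgZ; exact: imQ|apply: itgZ; exact: imP].
have mass0 x u : 0 <= segint x 0 (mass u) by apply: segint_ge0 => t _; exact: mass_ge0.
have bP x : x <= 0 -> segint x 0 (mass P) <= 2 * M / del ^+ 2.
  move=> x0; have := dens x x0; have := mass0 x Q => h1 h2.
  have h3 : del / 2 * segint x 0 (mass P) <= M / del.
    by have := mulr_ge0 (ltW g0) h1; lra.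
  have -> : 2 * M / del ^+ 2 = (M / del) / (del / 2) by field; rewrite lt0r_neq0.
  by rewrite ler_pdivlMr ?divr_gt0// mulrC.
have bQ x : x <= 0 -> segint x 0 (mass Q) <= M / del / gap a1 b1.
  move=> x0; have := dens x x0; have := mass0 x P => h1 h2.
  rewrite ler_pdivlMr// mulrC; have d2 : 0 <= del / 2 by rewrite divr_ge0// ltW.
  by have := mulr_ge0 d2 h1; lra.
pose L := 4 * ((1 + 4 * K + `|c| + `|m| + `|nu|) / gap a1 b1) ^+ 2.
have L0 : 0 <= L by rewrite mulr_ge0 ?sqr_ge0.
have rL b t : t <= 0 -> r b t ^+ 2 <= L * (mass ff t + mass P t + mass Q t).
  by move=> t0; exact: (second_join_sqr_le c m nu g0 brL brR).
have mr b x : x <= 0 -> measurable_fun `[x, 0] (r b).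
  by move=> x0; exact: itg_meas (pQ b x x0).1.
have im3 x : x <= 0 -> itg x 0 (fun t => L * (mass ff t + mass P t + mass Q t)).
  by move=> x0; apply: itgZ; apply: itgD; [apply: itgD|]; auto.
have ir b x : x <= 0 -> itg x 0 (fun t => r b t ^+ 2).
  move=> x0; apply: le_itg (im3 x x0) _; first by apply: measurable_funX; exact: mr.
  move=> t /andP[_ t0]; rewrite !ger0_norm ?sqr_ge0//; first exact: rL.
  apply: mulr_ge0 => //; apply: addr_ge0; last exact: mass_ge0.
  by apply: addr_ge0; exact: mass_ge0.
have br b x : x <= 0 -> segint x 0 (fun t => r b t ^+ 2) <=
    L * (M + 2 * M / del ^+ 2 + M / del / gap a1 b1).
  move=> x0; apply: (@le_trans _ _ (segint x 0 (fun t => L * (mass ff t + mass P t + mass Q t)))).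
    by apply: le_segint; [exact: ir|exact: im3|move=> t /andP[_ t0]; exact: rL].
  rewrite segintZ; last by apply: itgD; [apply: itgD|]; auto.
  apply: ler_wpM2l => //.
  rewrite segintD; [|by apply: itgD; auto|by auto]; rewrite segintD; [|by auto..].
  by apply: lerD; [apply: lerD|]; [exact: df.2|exact: bP|exact: bQ].
have le_mass b (u : bool -> R -> R) x (B : R) : (forall b', itg x 0 (fun t => u b' t ^+ 2)) ->
    segint x 0 (mass u) <= B -> segint x 0 (fun t => u b t ^+ 2) <= B.
  move=> iu; apply: le_trans; apply: le_segint => //; first by apply: itgD.
  move=> t _; rewrite /mass; have := sqr_ge0 (u true t); have := sqr_ge0 (u false t).
  by case: b; lra.
have inI (x : itv_bound R) y t : t \in Interval x (BLeft y) -> t < y.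
  by rewrite itv_boundlr bnd_simp => /andP[].
have subI (x : itv_bound R) y : y <= 0 ->
    [set` Interval x (BLeft y)] `<=` `]-oo, (0 : R)].
  by move=> y0 t /= /inI ty; rewrite in_itv/=; lra.
have LP b (x : itv_bound R) y : y <= 0 -> P b \_ [set` Interval x (BLeft y)] \in Lfun mu 2%:E.
  move=> y0; apply: (@Lfun2_patch _ _ (2 * M / del ^+ 2)) => //; first exact: subI.
  - by move=> w w0; exact: primitive_meas (pP b w w0).
  - by move=> w w0; exact: iP.
  - by move=> w w0; apply: le_mass (bP w w0) => b'; exact: iP.
have LQ b (x : itv_bound R) y : y <= 0 -> Q b \_ [set` Interval x (BLeft y)] \in Lfun mu 2%:E.
  move=> y0; apply: (@Lfun2_patch _ _ (M / del / gap a1 b1)) => //; first exact: subI.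
  - by move=> w w0; exact: primitive_meas (pQ b w w0).
  - by move=> w w0; exact: iQ.
  - by move=> w w0; apply: le_mass (bQ w w0) => b'; exact: iQ.
have LdP b (x : itv_bound R) y : y <= 0 -> derive1 (P b) \_ [set` Interval x (BLeft y)] \in Lfun mu 2%:E.
  move=> y0; suff -> : derive1 (P b) \_ [set` Interval x (BLeft y)] =
      Q b \_ [set` Interval x (BLeft y)] by exact: LQ.
  apply/funext => t; rewrite /patch; case: ifP => //.
  by rewrite mem_setE => /inI ty; rewrite dP1//; lra.
have Lr b (x : itv_bound R) y : y <= 0 -> r b \_ [set` Interval x (BLeft y)] \in Lfun mu 2%:E.
  move=> y0; apply: (@Lfun2_patch _ _ (L * (M + 2 * M / del ^+ 2 + M / del / gap a1 b1))) => //.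
  - exact: subI.
  - by move=> w w0; exact: mr.
  - by move=> w w0; exact: ir.
  - by move=> w w0; exact: br.
pose p z := P true z +i* P false z.
have h2 (x : itv_bound R) y : y <= 0 -> H2 [set` Interval x (BLeft y)] p.
  move=> y0; split.
  - move=> z /= /inI zy.
    by split; [have [] := dP true z|have [] := dP false z] => //; lra.
  - by split; exact: LP.
  - by split; exact: LdP.
  - exists (fun t => r true t +i* r false t); first by split; exact: Lr.
    move=> s t /= /inI sy /inI ty st.
    have s0 : s <= 0 by lra.
    have t0 : t <= 0 by lra.
    rewrite /deriv_c !dP1 /=; [|lra..].
    have e b : Q b t - Q b s = \int[mu]_(w in `[s, t]) r b w.
      by rewrite (pQ b s s0).2.
    by rewrite /Rintegral_c -[ReF _]/(r true) -[ImF _]/(r false) -!e.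
exists p; split.
- split.
  + by split; exact: LP.
  + exact: h2 (ltW zs0).
  + exact: h2.
  + have n10 : -1 < 0 :> R by lra.
    have h b : P b z @[z --> 0^'-] --> (0 : R).
      by have := primitive_cvg_left n10 (pP b _ (ltW n10)); rewrite P0.
    by split; exact: h.
  + have h b : {for zs, continuous (derive1 (P b))}.
      rewrite /prop_for /continuous_at dP1//.
      apply: cvg_trans (cQ b zs zs0); apply: near_eq_cvg.
      near=> z; rewrite dP1//; near: z; exact: lt_nbhsl.
    by split; split; [exact: cP|exact: cP|exact: h|exact: h].
- have aeQ : {ae mu, forall t, forall b, t < 0 -> is_derive t 1 (Q b) (r b t)}.
    have h b := @primitive_ae_derive_half R (Q b) (r b) (pQ b).
    by apply: aeS (aeI (h true) (h false)) => t [h1 h3] [].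
  apply: aeS (aeI aeQ (ae_neq zs)) => t [q1 tz]; rewrite /= in_itv/= => t0.
  have E0 b y : y < 0 -> y != zs -> is_derive y 1 (comp b p) (Q b y).
    by move=> hy _; case: b; exact: dP.
  have E1 := comp_lin_op t0 tz E0 (fun b => q1 b t0).
  have E2 b : comp b (fun z => lin_op a1 b1 k ubar p z - lambda * p z) t = comp b f t.
    rewrite E1.
    rewrite /r /second (join_profile D)// (join_profile D1)// (join_profile D2)// (join_profile N)//.
    have Dt := Dif_ubar_neq0 t0 tz.
    rewrite [D _ * _]mulrCA mulrV ?unitfE// mulr1.
    have -> : ff b t = comp b f t by rewrite /ff patchE ifT// mem_setE in_itv.
    have cpt b' : comp b' p t = P b' t by case: b'.
    rewrite !cpt; lra.
  have := E2 true; have := E2 false; rewrite /comp /ReF /ImF.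
  case: (lin_op _ _ _ _ _ _ - _) => u1 u2; case: (f t) => u3 u4 /=.
  by move=> -> ->.
rewrite !L2norm_mass.
have -> : (\int[mu]_(t in Iz) (mass (fun b => comp b f) t)%:E)%E = M%:E.
  rewrite integral_mkcond /M EFinD !fineK; [|
    exact: integrable_fin_num (Lfun2_integrable_sqr (ffL _))..].
  have iff b := Lfun2_integrable_sqr (ffL b).
  rewrite -(integralD measurableT (iff true) (iff false)).
  apply: eq_integral => t _; rewrite /ff /mass /= /patch.
  by case: ifP => // _; rewrite expr0n /= addr0.
have le1 : (\int[mu]_(t in Iz) (mass (fun b => comp b p) t)%:E <= (2 * M / del ^+ 2)%:E)%E.
  apply: le_trans (segint_le_half_line (g := mass P) _ imP bP); last first.
    by move=> t _; exact: mass_ge0.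
  apply: ge0_subset_integral => //.
  - apply/measurable_EFinP; apply: measurable_half_line => x x0.
    exact: itg_meas (imP x x0).
  - by move=> t _; rewrite lee_fin mass_ge0.
  - by move=> t; rewrite /= !in_itv/= => /ltW.
have B0 : 0 <= 2 * M / del ^+ 2.
  by apply: divr_ge0; [exact: mulr_ge0|exact: sqr_ge0].
apply: le_trans (gt0_ler_poweR _ _ _ le1) _.
- by rewrite invr_ge0.
- by rewrite in_itv/= leey andbT integral_ge0// => t _; rewrite lee_fin mass_ge0.
- by rewrite in_itv/= leey andbT lee_fin.
rewrite !poweR_EFin -EFinM lee_fin.
have -> : 2 / del = ((2 / del) ^+ 2) `^ 2^-1.
  by rewrite powR12_sqrt ?sqr_ge0// sqrtr_sqr ger0_norm// divr_ge0// ltW.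
rewrite -powRM ?sqr_ge0//; apply: ge0_ler_powR; rewrite ?nnegrE ?invr_ge0//.
- by apply: mulr_ge0 => //; exact: sqr_ge0.
rewrite expr_div_n mulrAC; apply: ler_wpM2r => //.
by apply: ler_wpM2r; [rewrite invr_ge0 sqr_ge0|rewrite expr2; lra].
Unshelve. all: by end_near. Qed.


Lemma resolvent_set :
  has_bounded_inverse Iz domain (lin_op a1 b1 k ubar) lambda.
Proof.
have [C hC] := resolvent_exists.
pose S f := if pselect (L2 Iz f) is left f2 then projT1 (cid (hC f f2)) else f.
have hS f : L2 Iz f -> [/\ domain (S f), resolvent_eq (S f) f &
    (L2norm Iz (S f) <= C%:E * L2norm Iz f)%E].
  move=> f2; rewrite /S; case: pselect => // f2'.
  exact: (projT2 (cid (hC f f2'))).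
exists S; split.
- by move=> f /hS[].
- move=> p f dp f2 ep; have [dS eS _] := hS f f2.
  apply: (aeS _ (ae_neq 0)) => t _; rewrite /= in_itv/= => t0.
  exact: resolvent_unique dS dp eS ep t t0.
- by exists C => f /hS[].
Qed.

End linearised_operator.

Unset Implicit Arguments.
Set Strict Implicit.
Set Printing Implicit Defensive.
Local Close Scope complex_scope.
Local Close Scope classical_set_scope.

Theorem theorem2p1 (R : realType) (a b k zs : R) (ubar : R -> R)
    (ha : 0 < a) (hab : a < b) (hb : b < 1)
    (hb1 : b < (a + 2) / 3) (hb2 : b < a * (2 + Num.sqrt 3))
    (hk : 0 < k)
    (hwave : shock_wave a b k zs ubar)
    (hneg : forall u : R, 0 <= u <= u_l a b \/ u_r a b <= u <= 1 ->
       Dzz a b k u / 2 + derive1 (Rsrc a b k) u < 0) :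
  spectrally_stable a b k zs ubar.
Proof.
move=> lambda; apply: contra_notT; rewrite -leNgt => m0.
exact: resolvent_set.
Qed.
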